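(* Let $q\ge1$, let $f\in C^q([-1,1];\mathbb R^2)$ with $f^{(q)}$ absolutely continuous, and let $p,r\in C^q[-1,1]$ be real-valued. For all sufficiently large $N$ let $n_1,\dots,n_{2q}$, $n_s=n_s(N)$, be distinct nonzero integers with $\alpha_0N\le|n_s|\le N$ for $s=1,\dots,2q$, where $0<\alpha_0<1$ is a fixed constant, and suppose that $$\lim_{N\to\infty}\frac{n_s}{N}=c_s\ne0,\qquad s=1,\dots,2q.$$ Let $E=\{s:n_s\text{ is even}\}$, $O=\{s:n_s\text{ is odd}\}$, and suppose that $|E|=|O|=q$ and that the limits $\{c_s:s\in E\}$ are pairwise distinct, as are $\{c_s:s\in O\}$. Let $g_k^\pm$ be the reduced boundary values of $f$ and $\widetilde g_k^\pm$ ($k=0,\dots,q-1$) their approximations obtained from the KEG-D system. Then, as $N\to\infty$, $$\widetilde g_k^\pm=g_k^\pm-g_q^+U_k^\pm-g_q^-V_k^\pm+o(N^{k-q}),\qquad k=0,\dots,q-1,$$ where $U_k^\pm$ and $V_k^\pm$ denote the coefficients of $x^k$ in the polynomials $$U^+=V^-=\tfrac12\bigl[\Pi_E+\Pi_O\bigr],\qquad U^-=V^+=-\tfrac12\bigl[\Pi_E-\Pi_O\bigr],$$ with $\Pi_E(x)=\prod_{s\in E}(x-x_{n_s})$, $\Pi_O(x)=\prod_{s\in O}(x-x_{n_s})$. In particular, $$\widetilde g_k^\pm-g_k^\pm=O(N^{k-q}),\qquad k=0,\dots,q-1.$$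
   Context: Dirac problem. Let $J=\begin{pmatrix}0&1\\-1&0\end{pmatrix}$, $Q(x)=\operatorname{diag}(p(x),r(x))$ and $\mathcal Ay:=Jy'-Qy$. Let $\alpha,\beta\in[0,\pi]$ and consider the self-adjoint eigenvalue problem $\mathcal Ay=\lambda y$ on $[-1,1]$ with boundary conditions $y_2(-1)\cos\alpha+y_1(-1)\sin\alpha=0$, $y_2(1)\cos\beta+y_1(1)\sin\beta=0$. It is assumed that $\lambda=0$ is not an eigenvalue. The eigenvalues $\{\lambda_n\}_{n\in\mathbb Z}$ are indexed in increasing order with the origin of the indexing chosen so that $\lambda_n=\frac{\pi n}{2}-\frac{\widetilde\theta}{2}+O(1/n)$ as $n\to\pm\infty$, where $\widetilde\theta=\beta-\alpha+\frac12\int_{-1}^1(p+r)\,d\tau$. The functions $\{v_n\}$ are the corresponding real orthonormal eigenfunctions in $L_2([-1,1];\mathbb R^2)$, with signs chosen so that, uniformly in $x$, $v_{n,1}(x)=K_0\cos(\xi_n(x)-\alpha)+O(1/n)$ and $v_{n,2}(x)=K_0\sin(\xi_n(x)-\alpha)+O(1/n)$ as $n\to\pm\infty$, where $K_0=1/\sqrt2$ and $\xi_n(x)=\lambda_n(x+1)+\frac12\int_{-1}^x(p+r)\,d\tau$. Put $x_n:=1/\lambda_n$. Real scalars $\kappa_n^{(\pm)}$ are defined by $v_n(1)=\kappa_n^{(+)}\binom{\cos\beta}{-\sin\beta}$, $v_n(-1)=\kappa_n^{(-)}\binom{\cos\alpha}{-\sin\alpha}$. Reduced boundary values. With $\gamma_+=\beta$,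 $\gamma_-=\alpha$, for $k=0,\dots,q$, $$g_k^\pm:=-(\mathcal A^kf)_2(\pm1)\cos\gamma_\pm-(\mathcal A^kf)_1(\pm1)\sin\gamma_\pm.$$ Fourier coefficients: $c_n:=\int_{-1}^1v_n^T(x)f(x)\,dx$ for $n\in\mathbb Z$ (not to be confused with the limits $c_s$ of $n_s/N$). KEG-D system. $\widetilde g_k^\pm=\widetilde g_k^\pm(N)$, $k=0,\dots,q-1$, denote the solution of the $2q\times2q$ linear system $$c_{n_s}=x_{n_s}\sum_{k=0}^{q-1}x_{n_s}^k\bigl[\kappa_{n_s}^{(+)}\widetilde g_k^+-\kappa_{n_s}^{(-)}\widetilde g_k^-\bigr],\qquad s=1,\dots,2q$$ (where $c_{n_s}$ is the Fourier coefficient of index $n_s$). Under the hypotheses of the claim this system is uniquely solvable for all sufficiently large $N$, so the $\widetilde g_k^\pm$ are well defined for such $N$. *)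

(* Defs.v *)
From mathcomp Require Import all_boot all_order all_algebra.
From mathcomp Require Import all_classical all_reals all_analysis.

Set Implicit Arguments.
Unset Strict Implicit.
Unset Printing Implicit Defensive.

Import Order.TTheory GRing.Theory Num.Theory.
Import numFieldNormedType.Exports.

Local Open Scope classical_set_scope.
Local Open Scope ring_scope.

Section Calculus.
Variable R : realType.

Definition I11 : set R := `[-1, 1].

(* Derivatives are taken inside [-1, 1], hence are one-sided at the endpoints:
   the values of a function outside [-1, 1] play no role, and the value of
   [derivI f] outside [-1, 1] is irrelevant. *)
Definition derivableI (f : R -> R) (x : R) : Prop :=
  cvg ((y - x)^-1 * (f y - f x) @[y --> within I11 x^']).

Definition derivI (f : R -> R) (x : R) : R :=
  lim ((y - x)^-1 * (f y - f x) @[y --> within I11 x^']).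

Definition derivnI (k : nat) (f : R -> R) : R -> R := iter k derivI f.

(* C^q[-1, 1] *)
Definition classC (q : nat) (f : R -> R) : Prop :=
  (forall k x, (k < q)%N -> I11 x -> derivableI (derivnI k f) x) /\
  (forall k, (k <= q)%N -> {within I11, continuous (derivnI k f)}).

Definition abs_continuousI (f : R -> R) : Prop :=
  forall e : R, 0 < e -> exists2 d : R, 0 < d &
    forall (m : nat) (a b : 'I_m -> R),
      (forall i, -1 <= a i /\ a i <= b i /\ b i <= 1) ->
      trivIset [set: 'I_m] (fun i => `]a i, b i[%classic) ->
      \sum_(i < m) (b i - a i) < d ->
      \sum_(i < m) `|f (b i) - f (a i)| < e.

(* e_n = O(1/n) as n -> +oo and n -> -oo *)
Definition bigO_inv (e : int -> R) : Prop :=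
  exists (C : R) (n0 : nat), forall n : int, (n0 <= `|n|)%N ->
    `|e n| <= C / `|n|%:~R.

(* the same, uniformly in x on [-1, 1] *)
Definition unif_bigO_inv (e : int -> R -> R) : Prop :=
  exists (C : R) (n0 : nat), forall n : int, (n0 <= `|n|)%N ->
    forall x, I11 x -> `|e n x| <= C / `|n|%:~R.

End Calculus.

(* R^2-valued functions are functions to 'cV[R]_2, with y_1 = y _ 0 0 and
   y_2 = y _ 1 0. *)
Section Dirac.
Variable R : realType.
Implicit Types (p r : R -> R) (y : R -> 'cV[R]_2).

Definition col2 (a b : R) : 'cV[R]_2 := \col_(i < 2) if i == 0 then a else b.

Definition comp1 y (x : R) : R := y x 0 0.
Definition comp2 y (x : R) : R := y x 1 0.

Definition dot2 (u w : 'cV[R]_2) : R := (u^T *m w) 0 0.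

Definition Jmx : 'M[R]_2 :=
  \matrix_(i < 2, j < 2)
    if (i == 0) && (j == 1) then 1 else if (i == 1) && (j == 0) then -1 else 0.

Definition Qmx p r (x : R) : 'M[R]_2 :=
  diag_mx (\row_(i < 2) if i == 0 then p x else r x).

Definition derivI2 y (x : R) : 'cV[R]_2 :=
  col2 (derivI (comp1 y) x) (derivI (comp2 y) x).

Definition Dirac p r y (x : R) : 'cV[R]_2 :=
  Jmx *m derivI2 y x - Qmx p r x *m y x.

Definition boundary_cond (alpha beta : R) y : Prop :=
  y (-1) 1 0 * cos alpha + y (-1) 0 0 * sin alpha = 0 /\
  y 1 1 0 * cos beta + y 1 0 0 * sin beta = 0.

Definition is_eigenfunction (alpha beta : R) p r (mu : R) y : Prop :=
  [/\ forall x, I11 x -> derivableI (comp1 y) x /\ derivableI (comp2 y) x,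
      forall x, I11 x -> Dirac p r y x = mu *: y x,
      boundary_cond alpha beta y
    & exists2 x, I11 x & y x != 0].

Definition is_eigenvalue (alpha beta : R) p r (mu : R) : Prop :=
  exists y, is_eigenfunction alpha beta p r mu y.

Definition inner2 y1 y2 : R :=
  \int[@lebesgue_measure R]_(x in @I11 R) dot2 (y1 x) (y2 x).

Definition theta_t (alpha beta : R) p r : R :=
  beta - alpha +
  2^-1 * \int[@lebesgue_measure R]_(t in `[-1, 1]) (p t + r t).

Definition K0 : R := 1 / Num.sqrt 2.

Definition xi p r (lam : int -> R) (n : int) (x : R) : R :=
  lam n * (x + 1) +
  2^-1 * \int[@lebesgue_measure R]_(t in `[-1, x]) (p t + r t).

(* [gred p r f beta 1 k] is g_k^+ and [gred p r f alpha (-1) k] is g_k^- *)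
Definition gred p r (f : R -> 'cV[R]_2) (gamma x : R) (k : nat) : R :=
  - (iter k (Dirac p r) f x 1 0 * cos gamma)
  - iter k (Dirac p r) f x 0 0 * sin gamma.

End Dirac.

Section KEG.
Variables (R : realType) (q m : nat).

(* [gp 0 k] and [gm 0 k] stand for the unknowns of index k with sign + and -;
   [ns] lists the Fourier indices n_s. *)
Definition keg_system (x c kp km : int -> R) (ns : 'I_m -> int)
    (gp gm : 'rV[R]_q) : Prop :=
  forall s : 'I_m,
    c (ns s) = x (ns s) *
      \sum_(k < q) x (ns s) ^+ k * (kp (ns s) * gp 0 k - km (ns s) * gm 0 k).

Definition Eset (ns : 'I_m -> int) : {set 'I_m} :=
  [set s | ~~ odd `|ns s|%N]%SET.
Definition Oset (ns : 'I_m -> int) : {set 'I_m} :=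
  [set s | odd `|ns s|%N]%SET.

Variables (x : int -> R) (ns : 'I_m -> int).

Definition PiE : {poly R} := \prod_(s in Eset ns) ('X - (x (ns s))%:P).
Definition PiO : {poly R} := \prod_(s in Oset ns) ('X - (x (ns s))%:P).

Definition Uplus : {poly R} := 2^-1 *: (PiE + PiO).
Definition Uminus : {poly R} := - (2^-1 *: (PiE - PiO)).
Definition Vplus : {poly R} := Uminus.
Definition Vminus : {poly R} := Uplus.

End KEG.

(* Main.v *)
Require Import Defs.
From mathcomp Require Import all_boot all_order all_algebra.
From mathcomp Require Import all_classical all_reals all_analysis.
From mathcomp Require Import zify ring lra.

Set Implicit Arguments.
Unset Strict Implicit.
Unset Printing Implicit Defensive.

Import Order.TTheory GRing.Theory Num.Theory.
Import numFieldNormedType.Exports.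

Local Open Scope classical_set_scope.
Local Open Scope ring_scope.

(** Three facts carry the theorem.

    Expansion of the Fourier coefficients. As [A v = lambda v], integration by
    parts moves [A] from the eigenfunction to [f]: [lambda <v, h>] is the boundary
    term [kappa^+ g^+ - kappa^- g^-] of [h] plus [<v, A h>]. Iterating from [h = f]
    up to [h = A^q f] gives
    [c_n = x_n sum_(k <= q) x_n^k (kappa_n^+ g_k^+ - kappa_n^- g_k^-)
           + x_n^(q+1) t_n] ([coef_expansion]).
    In the last step [h = A^q f] is only absolutely continuous, and what has to be
    shown is [t_n -> 0] ([expansion_tail_cvg0]).

    The remainder [t_n] is a combination of quantities
    [int v' h - [v h] = - int v dh] and [int v h]. It tends to 0 because [dh] has
    an integrable density and [v] oscillates. In place of the density, the proof
    uses that the slopes of the polygons inscribed in the graph of [h] on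
    uniform partitions are, in L1, almost unchanged by refinement of a suitable
    partition ([AC_uniform_refinement]). Then [dh] may be replaced by a step
    density, and [v] integrates to [O(1/lambda)] over a fixed interval since
    [lambda v = A v]. For the slopes, note that the length of the polygon increases
    under refinement and is bounded. Take a partition whose length is almost the
    supremum: the Jensen gap for [sqrt (1 + t^2)] under any refinement is then
    almost 0, and this gap controls the change of the slopes where they are
    bounded, while absolute continuity makes the steep cells negligible.

    Linear algebra. The boundary scalars satisfy [kappa^- -> K0] and
    [kappa^+ = (-1)^n K0 + o(1)] ([km_near], [kp_near]). So for the differences
    [d_k^+, d_k^-] between unknowns and reduced boundary values the system reads
    [sum_(k < q) x^k (d_k^+ - d_k^-) = (g_q^+ - g_q^-) x^q + ...] at the nodes of
    even index and [sum_(k < q) x^k (d_k^+ + d_k^-) = (g_q^+ + g_q^-) x^q + ...] at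
    those of odd index. The polynomial of degree [< q] that takes the values
    [a x^q] at the roots of a monic polynomial [Pi] of degree [q] is
    [a (x^q - Pi)]: hence the main terms with [PiE] and [PiO]. When the variable
    is rescaled by [N], the nodes tend to the points [2 / (pi c_s)], distinct
    within each parity class, so that the two interpolation problems are uniformly
    well conditioned and absorb the perturbation of the scalars
    ([parity_stability]). This gives unique solvability, and, as the coefficient
    of [x^k] in the error is scaled by [N^(q-k)], the remainder [o(N^(k-q))]. *)

(** * Absolutely continuous functions on uniform partitions *)

Section UniformPartitions.
Variable R : realType.
Implicit Types (h : R -> R) (L K M b i : nat).

Definition node M i : R := -1 + 2 * i%:R / M%:R.

Definition incr h M i : R := h (node M i.+1) - h (node M i).

Lemma big_nat_block (F : nat -> R) L K :
  \sum_(0 <= i < L * K) F i = \sum_(0 <= b < L) \sum_(0 <= i < K) F (b * K + i)%N.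
Proof.
elim: L => [|L IH]; first by rewrite mul0n !big_geq.
rewrite mulSnr (@big_cat_nat _ _ _ (L * K)) ?leq_addr //= IH big_nat_recr //=.
congr (_ + _).
by rewrite -{1}[(L * K)%N]add0n big_addn addKn; under eq_bigr do rewrite addnC.
Qed.

Lemma node_ge M i : -1 <= node M i.
Proof. by rewrite lerDl mulr_ge0 ?invr_ge0 ?mulr_ge0. Qed.

Lemma node_le1 M i : (i <= M)%N -> node M i <= 1.
Proof.
move=> iM; case: M iM => [|M iM].
  by rewrite leqn0 => /eqP ->; rewrite /node mulr0 mul0r addr0; lra.
rewrite /node -lerBrDl opprK [leRHS](_ : _ = 2); last by lra.
by rewrite ler_pdivrMr ?ltr0n // ler_wpM2l // ler_nat.
Qed.

Lemma node_le M i j : (i <= j)%N -> node M i <= node M j.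
Proof.
move=> ij; rewrite /node lerD2l ler_wpM2r ?invr_ge0 //.
by rewrite ler_wpM2l // ler_nat.
Qed.

Lemma nodeS M i : node M i.+1 - node M i = 2 / M%:R.
Proof. by rewrite /node -natr1; lra. Qed.

Lemma node0 M : node M 0 = -1.
Proof. by rewrite /node mulr0 mul0r addr0. Qed.

Lemma node_last M : (0 < M)%N -> node M M = 1.
Proof.
by move=> M0; rewrite /node mulfK ?pnatr_eq0 -?lt0n //; lra.
Qed.

Lemma node_block L K b : (0 < K)%N -> node (L * K) (b * K) = node L b.
Proof.
move=> K0; rewrite /node !natrM.
case: L => [|L]; first by rewrite mul0r invr0 !mulr0.
by congr (_ + _); field; rewrite !nat1r !pnatr_eq0 -!lt0n ?K0.
Qed.

Lemma incr_block h L K b : (0 < K)%N ->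
  \sum_(0 <= i < K) incr h (L * K) (b * K + i) = incr h L b.
Proof.
move=> K0; rewrite /incr.
rewrite (eq_big_nat _ _ (F2 := fun i => h (node (L * K) (b * K + i.+1))
   - h (node (L * K) (b * K + i)))); last by move=> i _; rewrite addnS.
rewrite (telescope_sumr (fun i => h (node (L * K) (b * K + i)))) //.
by rewrite addn0 -mulSnr !node_block.
Qed.

(** Absolute continuity along a subset of the cells of a uniform partition; the
    cells left out are replaced by empty intervals. *)
Lemma AC_cells h : abs_continuousI h -> forall e : R, 0 < e ->
  exists2 d : R, 0 < d & forall M (A : pred nat), (0 < M)%N ->
    \sum_(0 <= i < M | A i) (2 / M%:R) < d ->
    \sum_(0 <= i < M | A i) `|incr h M i| < e.
Proof.
move=> hAC e e0; have [d d0 hd] := hAC e e0; exists d => // M A M0.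
rewrite !big_mkord => sd.
pose a (i : 'I_M) := node M i.
pose b (i : 'I_M) := if A i then node M i.+1 else node M i.
have := hd M a b; rewrite [in X in _ -> _ -> X]big_mkcond /= => H.
rewrite [ltLHS]big_mkcond [ltLHS](_ : _ = \sum_(i < M) `|h (b i) - h (a i)|).
  2: { apply: eq_bigr => i _; rewrite /b /a /incr; case: (A i) => //.
       by rewrite subrr normr0. }
apply: H.
- move=> i; rewrite /a /b; split; first exact: node_ge.
  case: (A i); split; rewrite ?node_le1 // ?(ltnW (ltn_ord i)) //.
  exact: node_le.
- apply/trivIsetP => i j _ _ ij; apply/seteqP; split=> [z|//]; rewrite /= !in_itv /=.
  move=> [/andP[iz zi] /andP[jz zj]].
  have bE k : b k <= node M k.+1 by rewrite /b; case: (A k) => //; exact: node_le.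
  have [ij'|ji|/val_inj] := ltngtP i j; last by move/eqP: ij.
  + have /= := lt_le_trans (lt_le_trans jz (le_trans (ltW zi) (bE i))) (node_le M ij').
    by rewrite ltxx.
  + have /= := lt_le_trans (lt_le_trans iz (le_trans (ltW zj) (bE j))) (node_le M ji).
    by rewrite ltxx.
- rewrite [ltLHS](_ : _ = \sum_(i < M | A i) (2 / M%:R)) //.
  rewrite [RHS]big_mkcond; apply: eq_bigr => i _; rewrite /a /b.
  by case: (A i); rewrite ?nodeS // subrr.
Qed.

(** On the common refinement with a partition into [K0] parts that are short
    enough for absolute continuity with bound 1, each part contributes at most
    1. *)
Lemma AC_variation h : abs_continuousI h ->
  exists2 V : R, 0 <= V & forall M, (0 < M)%N ->
    \sum_(0 <= i < M) `|incr h M i| <= V.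
Proof.
move=> hAC; have [d d0 hd] := AC_cells hAC ltr01.
have [K0 K00 K0d] : exists2 K0, (0 < K0)%N & 2 / K0%:R < d.
  exists (Num.truncn (2 / d)).+1 => //.
  rewrite ltr_pdivrMr ?ltr0n // mulrC -ltr_pdivrMr //.
  exact: truncnS_gt.
exists K0%:R => // M M0.
(* compare with the common refinement, then regroup it into K0 parts *)
apply: (@le_trans _ _ (\sum_(0 <= i < M * K0) `|incr h (M * K0) i|)).
  rewrite big_nat_block; apply: ler_sum => b _.
  by rewrite -(incr_block h M b K00) ler_norm_sum.
rewrite mulnC big_nat_block.
apply: (@le_trans _ _ (\sum_(0 <= b < K0) 1)); last first.
  by rewrite big_const_nat iter_addr_0 subn0.
rewrite big_nat [leRHS]big_nat; apply: ler_sum => b bK.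
pose A (i : nat) := ((b * M <= i) && (i < b * M + M))%N.
have sumA (F : nat -> R) : \sum_(0 <= i < K0 * M | A i) F i =
    \sum_(0 <= i < M) F (b * M + i)%N.
  have bM : (b * M + M <= K0 * M)%N by rewrite -mulSnr leq_pmul2r //; lia.
  rewrite (@big_cat_nat _ _ _ (b * M)) //=; last by lia.
  rewrite [X in X + _]big1_seq ?add0r; last first.
    move=> i /andP[/andP[h1 h2]]; rewrite mem_index_iota; lia.
  rewrite (@big_cat_nat _ _ _ (b * M + M)) //=; last by lia.
  rewrite [X in _ + X]big1_seq ?addr0; last first.
    move=> i /andP[/andP[h1 h2]]; rewrite mem_index_iota; lia.
  rewrite big_nat_cond (eq_bigl (fun i => (b * M <= i < b * M + M)%N)); last first.
    by move=> i; rewrite /A andbb.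
  rewrite -big_nat -{1}[(b * M)%N]add0n big_addn addKn.
  by under eq_bigr do rewrite addnC.
rewrite -(sumA (fun i => `|incr h (K0 * M) i|)) ltW // hd ?muln_gt0 ?K00 //.
rewrite (sumA (fun=> _)) big_const_nat subn0 iter_addr_0 natrM.
rewrite [ltLHS](_ : _ = 2 / K0%:R) // -mulr_natr.
by field; rewrite !pnatr_eq0 -!lt0n K00.
Qed.

Definition slope h M i : R := incr h M i / (2 / M%:R).

(** By Markov's inequality the cells of slope above [T] have total length at
    most [V / T], where [V] bounds the variation, and absolute continuity
    applies to them. *)
Lemma AC_uniform_integrability h : abs_continuousI h -> forall e : R, 0 < e ->
  exists2 T : R, 0 < T & forall M, (0 < M)%N ->
    \sum_(0 <= i < M | T < `|slope h M i|) `|incr h M i| < e.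
Proof.
move=> hAC e e0; have [d d0 hd] := AC_cells hAC e0.
have [V V0 hV] := AC_variation hAC.
have T0 : 0 < (V + 1) / d by rewrite divr_gt0 // ltr_wpDl.
exists ((V + 1) / d) => // M M0; apply: hd => //.
have dM : 0 < 2 / M%:R :> R by rewrite divr_gt0 ?ltr0n.
apply: (@le_lt_trans _ _ (d / (V + 1) * V)); last first.
  by rewrite mulrAC ltr_pdivrMr ?ltr_wpDl // ltr_pM2l //; lra.
apply: (@le_trans _ _ (d / (V + 1) *
    \sum_(0 <= i < M | (V + 1) / d < `|slope h M i|) `|incr h M i|)); last first.
  apply: ler_wpM2l; first by rewrite divr_ge0 // ?ltW // ltr_wpDl.
  apply: le_trans (hV M M0); rewrite big_mkcond /=.
  by apply: ler_sum => i _; case: ifP.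
rewrite mulr_sumr; apply: ler_sum => i.
rewrite /slope normrM normfV (ger0_norm (ltW dM)) ltr_pdivlMr // => /ltW Ti.
by rewrite -[d / _]invf_div -ler_pdivrMl ?invr_gt0 // invrK.
Qed.

(** The length of a graph of slope [t] over a unit interval: a strictly convex
    function of linear growth. *)
Definition arc (t : R) : R := Num.sqrt (1 + t ^+ 2).

Lemma arc_gt0 t : 0 < arc t.
Proof. by rewrite sqrtr_gt0 ltr_pwDl // sqr_ge0. Qed.

Lemma sqr_arc t : arc t ^+ 2 = 1 + t ^+ 2.
Proof. by rewrite sqr_sqrtr // addr_ge0 // sqr_ge0. Qed.

Lemma arc_le t : arc t <= 1 + `|t|.
Proof.
rewrite -(ler_pXn2r (n := 2)) ?nnegrE ?(ltW (arc_gt0 _)) ?addr_ge0 //.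
rewrite sqr_arc sqrrD expr1n mul1r -addrA lerD2l -[t ^+ 2]real_normK ?num_real //.
by rewrite lerDr mulrn_wge0.
Qed.

(** The gap between [arc] and its tangent at [w]. *)
Definition arc_defect (u w : R) : R := arc u - arc w - w / arc w * (u - w).

(** With [P = arc u * arc w] and [c = 1 + u * w] one has [(u - w)^2 = P^2 - c^2
    = (P + c)(P - c)], while [arc_defect u w = (P - c) / arc w]. *)
Lemma arc_defect_sqr u w :
  (u - w) ^+ 2 <= 2 * arc u * arc w ^+ 2 * arc_defect u w.
Proof.
have u0 := arc_gt0 u; have w0 := arc_gt0 w.
have u2 := sqr_arc u; have w2 := sqr_arc w.
have -> : 2 * arc u * arc w ^+ 2 * arc_defect u w =
    2 * (arc u * arc w) * (arc u * arc w - (1 + u * w)).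
  rewrite /arc_defect; transitivity (2 * arc u * arc w * (arc u * arc w - arc w ^+ 2 - w * (u - w))).
    by field; rewrite gt_eqF.
  by rewrite w2; ring.
have P0 : 0 < arc u * arc w by rewrite mulr_gt0.
have P2 : (arc u * arc w) ^+ 2 = (1 + u * w) ^+ 2 + (u - w) ^+ 2.
  by rewrite exprMn u2 w2; ring.
move: P0 P2; move: (arc u * arc w) => P P0 P2.
have cP : 1 + u * w <= P.
  rewrite (le_trans (ler_norm _)) // -(ler_pXn2r (n := 2)) ?nnegrE ?normr_ge0 ?(ltW P0) //.
  by rewrite real_normK ?num_real // P2 lerDl sqr_ge0.
have -> : (u - w) ^+ 2 = (P + (1 + u * w)) * (P - (1 + u * w)).
  by rewrite mulrC -subr_sqr P2; ring.
by apply: ler_wpM2r; lra.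
Qed.

Lemma arc_defect_ge0 u w : 0 <= arc_defect u w.
Proof.
have := le_trans (sqr_ge0 _) (arc_defect_sqr u w).
by rewrite pmulr_rge0 // !mulr_gt0 ?arc_gt0 // exprn_gt0 ?arc_gt0.
Qed.

(** For slopes bounded by [T], apply [z <= eta + z^2 / eta] to [z = |u - w|]
    and then [arc_defect_sqr]; if one of the slopes exceeds [T], twice the
    larger one bounds [|u - w|]. *)
Lemma arc_defect_dist (T eta u w : R) : 0 < T -> 0 < eta ->
  `|u - w| <= eta + 2 * (1 + T) ^+ 3 / eta * arc_defect u w
    + 2 * (if T < `|u| then `|u| else 0) + 2 * (if T < `|w| then `|w| else 0).
Proof.
move=> T0 eta0.
have [uw|uw] := boolP ((`|u| <= T) && (`|w| <= T)); last first.
  have D0 : 0 <= eta + 2 * (1 + T) ^+ 3 / eta * arc_defect u w.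
    rewrite addr_ge0 ?(ltW eta0) // mulr_ge0 ?arc_defect_ge0 //.
    by rewrite divr_ge0 ?(ltW eta0) // mulr_ge0 // exprn_ge0 // addr_ge0 // ltW.
  rewrite -addrA (le_trans (ler_normB _ _)) // -[leLHS]add0r lerD //.
  move: uw; rewrite negb_and -!ltNge => /orP[] Th; rewrite Th;
    case: ltP; move: Th; lra.
have /andP[uT wT] := uw; rewrite !ltNge uT wT /= !mulr0 !addr0.
have le1 : `|u - w| <= eta + (u - w) ^+ 2 / eta.
  rewrite -[(u - w) ^+ 2]real_normK ?num_real //; move: (normr_ge0 (u - w)); set z : R := `|u - w| => z0.
  have [ze|ez] := leP z eta; first by rewrite ler_wpDr // divr_ge0 ?sqr_ge0 // ltW.
  by rewrite ler_wpDl ?(ltW eta0) // ler_pdivlMr // expr2 ler_wpM2l // ltW.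
apply: (le_trans le1).
rewrite lerD2l [leRHS]mulrAC ler_wpM2r ?invr_ge0 ?(ltW eta0) //.
rewrite (le_trans (arc_defect_sqr _ _)) // ler_wpM2r ?arc_defect_ge0 //.
rewrite -mulrA ler_wpM2l // exprS ler_pM ?mulr_ge0 ?exprn_ge0 ?(ltW (arc_gt0 _)) //.
  by rewrite (le_trans (arc_le _)) // lerD2l.
have wT1 : arc w <= 1 + T by rewrite (le_trans (arc_le _)) // lerD2l.
by rewrite ler_pM ?(ltW (arc_gt0 _)).
Qed.

Definition polygon_length h M : R := \sum_(0 <= i < M) (2 / M%:R) * arc (slope h M i).

Lemma polygon_length_bounded h : abs_continuousI h ->
  exists V : R, forall M, (0 < M)%N -> polygon_length h M <= V.
Proof.
move=> hAC; have [V V0 hV] := AC_variation hAC; exists (2 + V) => M M0.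
have dM : 0 < 2 / M%:R :> R by rewrite divr_gt0 ?ltr0n.
apply: (@le_trans _ _ (\sum_(0 <= i < M) (2 / M%:R + `|incr h M i|))).
  apply: ler_sum => i _; apply: (@le_trans _ _ (2 / M%:R * (1 + `|slope h M i|))).
    by rewrite ler_wpM2l ?(ltW dM) // arc_le.
  rewrite mulrDr mulr1 lerD2l /slope normrM normfV (ger0_norm (ltW dM)).
  by rewrite mulrCA divff ?mulr1 // gt_eqF.
rewrite big_split /= lerD ?hV // big_const_nat subn0 iter_addr_0 -[leLHS]mulr_natr.
by rewrite divfK // pnatr_eq0 -lt0n.
Qed.

(** The terms of the defects that are linear in the slopes cancel, because the
    slope on a block is the mean of the slopes on its cells. *)
Lemma polygon_length_refine h L K : (0 < L)%N -> (0 < K)%N ->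
  \sum_(0 <= b < L) \sum_(0 <= i < K) (2 / (L * K)%:R) *
    arc_defect (slope h (L * K) (b * K + i)) (slope h L b) =
  polygon_length h (L * K) - polygon_length h L.
Proof.
move=> L0 K0; rewrite /polygon_length big_nat_block -sumrB.
apply: eq_bigr => b _; set w := slope h L b; set d := 2 / (L * K)%:R.
have d0 : d != 0 by rewrite /d mulf_neq0 // invr_eq0 pnatr_eq0 -lt0n muln_gt0 L0.
have dK : 2 / L%:R = d * K%:R.
  by rewrite /d natrM; field; rewrite !pnatr_eq0 -!lt0n L0 K0.
rewrite (eq_bigr (fun i => d * arc (slope h (L * K) (b * K + i)) - d * arc w -
  w / arc w * (d * slope h (L * K) (b * K + i) - d * w))); last first.
  by move=> i _; rewrite /arc_defect; ring.
rewrite !sumrB -addrA; congr (_ + _).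
rewrite -[X in _ - X]mulr_sumr sumrB -mulr_sumr !big_const_nat subn0 !iter_addr_0.
rewrite -[arc w *+ K]mulr_natr -[d * w *+ K]mulr_natr.
rewrite (eq_bigr (fun i => incr h (L * K) (b * K + i))); last first.
  by move=> i _; rewrite /slope mulrC divfK.
rewrite incr_block // /w /slope dK.
have K1 : K%:R != 0 :> R by rewrite pnatr_eq0 -lt0n.
have a0 : arc (incr h L b / (d * K%:R)) != 0 by rewrite gt_eqF ?arc_gt0.
by field; rewrite d0 K1 a0.
Qed.

(** The slopes on the partition into [L] blocks are nearly those on every
    refinement, in L1: a substitute for the approximation of the derivative of
    [h] by step functions. [L] is chosen so that the polygon length is almost
    its supremum. *)
Lemma AC_uniform_refinement h : abs_continuousI h -> forall e : R, 0 < e ->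
  exists2 L, (0 < L)%N & forall K, (0 < K)%N ->
    \sum_(0 <= b < L) \sum_(0 <= i < K)
      `|incr h (L * K) (b * K + i) - incr h L b / K%:R| <= e.
Proof.
move=> hAC e e0.
(* in units of e / 16 the four error terms are 2, 1, 2 and 2 *)
have e16 : 0 < e / 16 by rewrite divr_gt0.
have [T T0 hT] := AC_uniform_integrability hAC e16.
have [V hV] := polygon_length_bounded hAC.
pose S := [set polygon_length h M | M in [set M | (0 < M)%N]].
have supS : has_sup S.
  split; first by exists (polygon_length h 1); exists 1%N.
  by exists V => _ [M M0 <-]; exact: hV.
pose c := 2 * (1 + T) ^+ 3 / (e / 16).
have c0 : 0 < c by rewrite divr_gt0 // mulr_gt0 // exprn_gt0 // ltr_pwDl // ltW.
have ec : 0 < e / 16 / c by rewrite divr_gt0.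
have [_ [L L0 <-] hL] := sup_adherent ec supS.
exists L => // K K0; have LK0 : (0 < L * K)%N by rewrite muln_gt0 L0.
have hLK : polygon_length h (L * K) - polygon_length h L <= e / 16 / c.
  have : polygon_length h (L * K) <= sup S by apply: ub_le_sup; [case: supS|exists (L * K)%N].
  lra.
pose d : R := 2 / (L * K)%:R.
have d0 : 0 < d by rewrite divr_gt0 // ltr0n.
have dK : 2 / L%:R = d * K%:R.
  by rewrite /d natrM; field; rewrite !pnatr_eq0 -!lt0n L0 K0.
pose big (z : R) : R := if T < `|z| then `|z| else 0.
have bigE M i : 2 / M%:R * big (slope h M i) =
    if T < `|slope h M i| then `|incr h M i| else 0.
  rewrite /big; case: ifP; last by rewrite mulr0.
  case: M => [|M]; first by rewrite /slope !(invr0, mulr0) normr0 ltNge ltW.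
  rewrite {2}/slope normrM normfV (ger0_norm (_ : 0 <= 2 / M.+1%:R)) ?divr_ge0 // => _.
  by rewrite mulrCA divff ?mulr1 // mulf_neq0.
apply: (@le_trans _ _ (\sum_(0 <= b < L) \sum_(0 <= i < K)
    (d * (e / 16) + c * (d * arc_defect (slope h (L * K) (b * K + i)) (slope h L b))
     + 2 * (d * big (slope h (L * K) (b * K + i))) + 2 * (d * big (slope h L b))))).
  apply: ler_sum => b _; apply: ler_sum => i _.
  have -> : incr h (L * K) (b * K + i) - incr h L b / K%:R =
      d * (slope h (L * K) (b * K + i) - slope h L b).
    rewrite /slope dK -/d; field.
    by rewrite pnatr_eq0 -lt0n K0 gt_eqF.
  rewrite normrM (ger0_norm (ltW d0)).
  have := arc_defect_dist (slope h (L * K) (b * K + i)) (slope h L b) T0 e16.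
  move=> /(ler_wpM2l (ltW d0)) /le_trans; apply.
  by rewrite le_eqVlt; apply/orP; left; apply/eqP; rewrite /big /c; ring.
under eq_bigr do rewrite !big_split /=.
rewrite !big_split /=.
have s2 : \sum_(0 <= b < L) \sum_(0 <= i < K)
      c * (d * arc_defect (slope h (L * K) (b * K + i)) (slope h L b)) =
    c * (polygon_length h (L * K) - polygon_length h L).
  under eq_bigr do rewrite -mulr_sumr.
  by rewrite -mulr_sumr -polygon_length_refine.
have s3 : \sum_(0 <= b < L) \sum_(0 <= i < K)
      2 * (d * big (slope h (L * K) (b * K + i))) =
    2 * \sum_(0 <= i < L * K | T < `|slope h (L * K) i|) `|incr h (L * K) i|.
  under eq_bigr do rewrite -mulr_sumr.
  rewrite -mulr_sumr -(big_nat_block (fun i => d * big (slope h (L * K) i))).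
  by rewrite [in RHS]big_mkcond /=; under eq_bigr do rewrite bigE.
have s1 : \sum_(0 <= b < L) \sum_(0 <= i < K) d * (e / 16) = 2 * (e / 16).
  rewrite -(big_nat_block (fun=> _)) big_const_nat subn0 iter_addr_0 -[LHS]mulr_natr mulrAC.
  by congr (_ * _); rewrite /d divfK // pnatr_eq0 -lt0n.
have s4 : \sum_(0 <= b < L) \sum_(0 <= i < K) 2 * (d * big (slope h L b)) =
    2 * \sum_(0 <= b < L | T < `|slope h L b|) `|incr h L b|.
  rewrite [in RHS]big_mkcond /= mulr_sumr; apply: eq_bigr => b _.
  rewrite big_const_nat subn0 iter_addr_0 -bigE dK -[LHS]mulr_natr; ring.
rewrite s1 s2 s3 s4.
have hc : c * (polygon_length h (L * K) - polygon_length h L) <= e / 16.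
  by rewrite -ler_pdivlMl // mulrC.
have := hT _ LK0; have := hT _ L0; move: hc.
lra.
Qed.

End UniformPartitions.

(** * Calculus on [-1, 1] with one-sided derivatives at the ends *)

Section OneSidedCalculus.
Variable R : realType.
Implicit Types (f g h : R -> R) (a b x : R).

Lemma I11P x : I11 x <-> -1 <= x <= 1.
Proof. by rewrite /I11 /= in_itv. Qed.

Lemma I11_1 : I11 (1 : R). Proof. by apply/I11P; lra. Qed.
Lemma I11_N1 : I11 (-1 : R). Proof. by apply/I11P; lra. Qed.

Lemma within_I11_proper x : I11 x -> ProperFilter (within (@I11 R) x^').
Proof.
move=> /I11P xI; apply: Build_ProperFilter_ex => P [d /= d0 hd].
have [x0|x0] := leP x 0.
  pose y := x + Num.min (d / 2) 1.
  have m0 : 0 < Num.min (d / 2) 1 by rewrite lt_min ltr01 divr_gt0.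
  have m1 : Num.min (d / 2) 1 <= 1 by rewrite ge_min lexx orbT.
  have m2 : Num.min (d / 2) 1 <= d / 2 by rewrite ge_min lexx.
  exists y; apply: hd.
  - by rewrite /ball /= /y opprD addNKr normrN gtr0_norm //; lra.
  - by rewrite /y; apply/eqP; lra.
  - by apply/I11P; rewrite /y; lra.
pose y := x - Num.min (d / 2) 1.
have m0 : 0 < Num.min (d / 2) 1 by rewrite lt_min ltr01 divr_gt0.
have m1 : Num.min (d / 2) 1 <= 1 by rewrite ge_min lexx orbT.
have m2 : Num.min (d / 2) 1 <= d / 2 by rewrite ge_min lexx.
exists y; apply: hd.
- by rewrite /ball /= /y subKr gtr0_norm //; lra.
- by rewrite /y; apply/eqP; lra.
- by apply/I11P; rewrite /y; lra.
Qed.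

(** [derivableI] together with [derivI], as one relation; this is the form that
    the rules of calculus preserve. *)
Definition has_deriv f x (d : R) : Prop :=
  (y - x)^-1 * (f y - f x) @[y --> within (@I11 R) x^'] --> d.

Lemma has_derivP f x d : I11 x ->
  has_deriv f x d <-> derivableI f x /\ derivI f x = d.
Proof.
move=> xI; have PF := within_I11_proper xI; split.
  move=> fd; split; first by apply/cvg_ex; exists d.
  exact: cvg_lim fd.
by case=> fd <-.
Qed.

Lemma has_deriv_derivI f x : derivableI f x -> has_deriv f x (derivI f x).
Proof. by []. Qed.

Lemma has_deriv_ext f g x d : (forall y, I11 y -> f y = g y) -> I11 x ->
  has_deriv f x d -> has_deriv g x d.
Proof.
move=> fg xI; apply: cvg_trans; apply: near_eq_cvg.
rewrite /prop_near1; apply: filterS (withinT _ (within_filter _ _)) => y yI.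
by rewrite !fg.
Qed.

Lemma has_deriv_cvg f x d : has_deriv f x d -> 
  f y @[y --> within (@I11 R) x^'] --> f x.
Proof.
move=> fd; have yx : (y - x) @[y --> within (@I11 R) x^'] --> (0 : R).
  rewrite -(subrr x); apply: cvgB; last exact: cvg_cst.
  by apply: cvg_within_filter; apply: cvg_within.
have : (y - x) * ((y - x)^-1 * (f y - f x)) + f x @[y --> within (@I11 R) x^'] --> 0 * d + f x.
  by apply: cvgD; [exact: cvgM|exact: cvg_cst].
rewrite mul0r add0r; apply: cvg_trans; apply: near_eq_cvg.
apply: cvg_within; near=> y.
have yx0 : y - x != 0 by rewrite subr_eq0; near: y; exact: nbhs_dnbhs_neq.
by rewrite mulrA divff // mul1r subrK.
Unshelve. all: by end_near. Qed.

Lemma has_derivD f g x d e : has_deriv f x d -> has_deriv g x e ->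
  has_deriv (fun y => f y + g y) x (d + e).
Proof.
move=> fd ge; rewrite /has_deriv.
rewrite [X in X @ _ --> _](_ : _ = fun y => (y - x)^-1 * (f y - f x) + (y - x)^-1 * (g y - g x)); last first.
  by apply/funext => y; ring.
exact: cvgD.
Qed.

Lemma has_deriv_scale f x d c : has_deriv f x d ->
  has_deriv (fun y => c * f y) x (c * d).
Proof.
move=> fd; rewrite /has_deriv.
rewrite [X in X @ _ --> _](_ : _ = fun y => c * ((y - x)^-1 * (f y - f x))); last first.
  by apply/funext => y; ring.
by apply: cvgM => //; exact: cvg_cst.
Qed.

Lemma has_derivM f g x d e : has_deriv f x d -> has_deriv g x e ->
  has_deriv (fun y => f y * g y) x (d * g x + f x * e).
Proof.
move=> fd ge; rewrite /has_deriv.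
rewrite [X in X @ _ --> _](_ : _ = fun y => (y - x)^-1 * (f y - f x) * g y + f x * ((y - x)^-1 * (g y - g x))); last first.
  by apply/funext => y; ring.
apply: cvgD; first by apply: cvgM => //; exact: has_deriv_cvg ge.
by apply: cvgM => //; exact: cvg_cst.
Qed.

(** Pointwise form of continuity of the restriction to [-1, 1]. *)
Definition contI f : Prop :=
  forall x, I11 x -> f y @[y --> within (@I11 R) (nbhs x)] --> f x.

Lemma contIP f : contI f <-> {within (@I11 R), continuous f}.
Proof. by rewrite subspace_continuousP. Qed.

Lemma contI_cst (c : R) : contI (fun=> c).
Proof. by move=> x _; exact: cvg_cst. Qed.

Lemma contID f g : contI f -> contI g -> contI (fun x => f x + g x).
Proof. by move=> cf cg x xI; apply: cvgD; [exact: cf|exact: cg]. Qed.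

Lemma contIM f g : contI f -> contI g -> contI (fun x => f x * g x).
Proof. by move=> cf cg x xI; apply: cvgM; [exact: cf|exact: cg]. Qed.

Lemma contIZ c f : contI f -> contI (fun x => c * f x).
Proof. by apply: contIM; exact: contI_cst. Qed.

Lemma contIN f : contI f -> contI (fun x => - f x).
Proof. by move=> cf x xI; apply: cvgN; exact: cf. Qed.

Lemma contIB f g : contI f -> contI g -> contI (fun x => f x - g x).
Proof. by move=> cf cg; apply: contID => //; exact: contIN. Qed.

Lemma contI_bounded f : contI f ->
  exists2 C, 0 <= C & forall x, I11 x -> `|f x| <= C.
Proof.
move=> /contIP cf.
have /compact_bounded [C [Cr hC]] : compact (f @` @I11 R).
  by apply: continuous_compact => //; exact: segment_compact.
exists (`|C| + 1) => [|x xI]; first by rewrite addr_ge0.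
by apply: hC; [rewrite (le_lt_trans (ler_norm C)) // ltrDl|exists x].
Qed.

(** The filter of [has_deriv] omits the point itself, where the value is
    trivially right. *)
Lemma derivable_contI f : (forall x, I11 x -> derivableI f x) -> contI f.
Proof.
move=> df x xI A /= fA.
have := has_deriv_cvg (has_deriv_derivI (df x xI)) fA.
rewrite /= !nbhs_simpl /within /= /prop_near1 !nbhs_simpl /= => hA.
rewrite /dnbhs /within /= in hA.
apply: (@filterS _ (nbhs x) _ _ _ _ hA) => y hy yI; have [->|yx] := eqVneq y x.
  exact: nbhs_singleton fA.
exact: hy.
Qed.

Lemma has_deriv_contI f g : (forall x, I11 x -> has_deriv f x (g x)) -> contI f.
Proof.
by move=> fg; apply: derivable_contI => x xI; apply/cvg_ex; exists (g x); exact: fg.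
Qed.

Lemma has_deriv_is_derive f x d : -1 < x < 1 -> has_deriv f x d ->
  is_derive x 1 f d.
Proof.
move=> xI fd.
suff H : h^-1 *: (f (h *: 1 + x) - f x) @[h --> (0 : R)^'] --> d.
  split; first by apply/cvg_ex; exists d.
  exact: cvg_lim H.
have sh : h + x @[h --> (0 : R)^'] --> within (@I11 R) x^'; last first.
  rewrite [X in X @ _](_ : _ = (fun y => (y - x)^-1 * (f y - f x)) \o (fun h : R => h + x)).
    exact: cvg_comp sh fd.
  by apply/funext => h /=; rewrite addrK scaler1.
move=> A [e /= e0 hA].
exists (Num.min e (Num.min (1 - x) (x + 1))) => /=.
  by rewrite !lt_min e0; lra.
move=> h /=; rewrite sub0r normrN !lt_min => /and3P[h1 h2 h3] h0.
move: h2 h3; rewrite !ltr_norml => h2 h3.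
apply: hA => /=.
- by rewrite /ball /= opprD addrCA subrr addr0 normrN.
- by apply: contra_neq h0 => h0; lra.
- by apply/I11P; lra.
Qed.

Definition integ f a b : R := \int[@lebesgue_measure R]_(x in `[a, b]) f x.

Lemma contI_within f a b : contI f -> -1 <= a -> b <= 1 ->
  {within `[a, b], continuous f}.
Proof.
move=> /contIP cf a1 b1; apply: continuous_subspaceW cf => x /=.
by rewrite in_itv /= => /andP[ax xb]; apply/I11P; lra.
Qed.

Lemma contI_integrable f a b : contI f -> -1 <= a -> b <= 1 ->
  (@lebesgue_measure R).-integrable `[a, b] (EFin \o f).
Proof.
move=> cf a1 b1; apply: continuous_compact_integrable; first exact: segment_compact.
exact: contI_within.
Qed.

Lemma eq_integ f g a b : (forall x, a <= x <= b -> f x = g x) ->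
  integ f a b = integ g a b.
Proof. by move=> fg; apply: eq_Rintegral => x; rewrite inE /= in_itv /=; exact: fg. Qed.

Lemma integD f g a b : contI f -> contI g -> -1 <= a -> b <= 1 ->
  integ (fun x => f x + g x) a b = integ f a b + integ g a b.
Proof. by move=> cf cg a1 b1; rewrite /integ RintegralD //; exact: contI_integrable. Qed.

Lemma integB f g a b : contI f -> contI g -> -1 <= a -> b <= 1 ->
  integ (fun x => f x - g x) a b = integ f a b - integ g a b.
Proof. by move=> cf cg a1 b1; rewrite /integ RintegralB //; exact: contI_integrable. Qed.

Lemma integZ c f a b : contI f -> -1 <= a -> b <= 1 ->
  integ (fun x => c * f x) a b = c * integ f a b.
Proof. by move=> cf a1 b1; rewrite /integ RintegralZl //; exact: contI_integrable. Qed.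

Lemma integ_cst c a b : a <= b -> integ (fun=> c) a b = c * (b - a).
Proof.
move=> ab; rewrite /integ Rintegral_cst //= lebesgue_measure_itv /= lte_fin.
have [ab'|ba] := ltP a b; first by rewrite -EFinD.
by have -> : a = b by [apply/eqP; rewrite eq_le ab]; rewrite subrr.
Qed.

Lemma integ_norm_le f C a b : contI f -> -1 <= a -> a <= b -> b <= 1 ->
  (forall x, a <= x <= b -> `|f x| <= C) -> `|integ f a b| <= C * (b - a).
Proof.
move=> cf a1 ab b1 fC; have fi := contI_integrable cf a1 b1.
rewrite -integ_cst //; apply: le_trans (le_normr_Rintegral _ fi) _ => //.
apply: le_Rintegral => //.
- exact: (integrable_norm fi).
- by apply: contI_integrable => //; exact: contI_cst.
Qed.

Lemma integ_cat f a c b : contI f -> -1 <= a -> a <= c -> c <= b -> b <= 1 ->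
  integ f a b = integ f a c + integ f c b.
Proof.
move=> cf a1 ac cb b1; apply/eqP; rewrite addrC -subr_eq; apply/eqP.
rewrite /integ Rintegral_itvB ?bnd_simp //; last exact: contI_integrable.
rewrite Rintegral_itv_obnd_cbnd //.
apply: integrableS (contI_integrable cf a1 b1) => //.
apply: subset_itv; by rewrite bnd_simp.
Qed.

(** Fundamental theorem of calculus on a subinterval, for derivatives that are
    one-sided at -1 and 1. *)
Lemma integ_deriv F g a b : (forall x, I11 x -> has_deriv F x (g x)) -> contI g ->
  -1 <= a -> a <= b -> b <= 1 -> integ g a b = F b - F a.
Proof.
move=> dF cg a1; rewrite le_eqVlt => /predU1P[<- _|ab b1].
  by rewrite /integ set_itv1 Rintegral_set1 subrr.
have cF : contI F := has_deriv_contI dF.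
rewrite /integ /Rintegral (@continuous_FTC2 _ g F a b ab) //.
- exact: contI_within.
- have /(continuous_within_itvP _ ab)[_ Fa Fb] := contI_within cF a1 b1.
  split => // x; rewrite in_itv /= => xab.
  have /dF/has_deriv_is_derive : I11 x by apply/I11P; lra.
  by move=> []; [lra|].
- move=> x; rewrite in_itv /= => xab.
  have /dF/has_deriv_is_derive : I11 x by apply/I11P; lra.
  by move=> []; [lra|move=> _ <-; rewrite derive1E].
Qed.

Lemma deriv_lipschitz F g : (forall x, I11 x -> has_deriv F x (g x)) -> contI g ->
  exists2 C, 0 <= C & forall a b, -1 <= a -> a <= b -> b <= 1 ->
    `|F b - F a| <= C * (b - a).
Proof.
move=> dF cg; have [C C0 gC] := contI_bounded cg; exists C => // a b a1 ab b1.
rewrite -(integ_deriv dF) //; apply: integ_norm_le => // x xab.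
by apply: gC; apply/I11P; lra.
Qed.

Lemma integ_nodes f M m n : contI f -> (m + n <= M)%N ->
  \sum_(0 <= i < n) integ f (node R M (m + i)) (node R M (m + i).+1) =
  integ f (node R M m) (node R M (m + n)).
Proof.
move=> cf; elim: n => [|n IH] mnM.
  by rewrite big_geq // addn0 /integ set_itv1 Rintegral_set1.
rewrite big_nat_recr //= IH ?addnS; last by lia.
rewrite -integ_cat ?node_ge ?node_le1 ?node_le //; lia.
Qed.

(** * Absolute continuity and its higher order variants *)

Lemma AC_ext f g : (forall x, I11 x -> f x = g x) ->
  abs_continuousI f -> abs_continuousI g.
Proof.
move=> fg fAC e e0; have [d d0 hd] := fAC e e0; exists d => // m a b abI tr sd.
rewrite (eq_bigr (fun i => `|f (b i) - f (a i)|)); first exact: hd.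
by move=> i _; have [? [? ?]] := abI i; rewrite !fg //; apply/I11P; lra.
Qed.

(** All closure properties of absolute continuity below are instances of this
    one: sums, multiples, products and Lipschitz functions. *)
Lemma AC_dominated f g h (A B : R) : abs_continuousI f -> abs_continuousI g ->
  0 <= A -> 0 <= B ->
  (forall a b, I11 a -> I11 b ->
     `|h b - h a| <= A * `|f b - f a| + B * `|g b - g a|) ->
  abs_continuousI h.
Proof.
move=> fAC gAC A0 B0 hfg e e0.
have eA : 0 < e / (2 * (A + 1)) by rewrite divr_gt0 // mulr_gt0 // ltr_wpDl.
have eB : 0 < e / (2 * (B + 1)) by rewrite divr_gt0 // mulr_gt0 // ltr_wpDl.
have [d1 d10 hd1] := fAC _ eA; have [d2 d20 hd2] := gAC _ eB.
exists (Num.min d1 d2); first by rewrite lt_min d10.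
move=> m a b abI tr; rewrite lt_min => /andP[s1 s2].
have H1 := hd1 m a b abI tr s1; have H2 := hd2 m a b abI tr s2.
apply: (@le_lt_trans _ _ (A * \sum_(i < m) `|f (b i) - f (a i)| +
    B * \sum_(i < m) `|g (b i) - g (a i)|)).
  rewrite !mulr_sumr -big_split /=; apply: ler_sum => i _.
  by have [? [? ?]] := abI i; apply: hfg; apply/I11P; lra.
have h1 : A * \sum_(i < m) `|f (b i) - f (a i)| <= e / 2 * (A / (A + 1)).
  rewrite [leRHS](_ : _ = A * (e / (2 * (A + 1)))); last first.
    by field; rewrite gt_eqF // ltr_wpDl.
  by rewrite ler_wpM2l // ltW.
have h2 : B * \sum_(i < m) `|g (b i) - g (a i)| <= e / 2 * (B / (B + 1)).
  rewrite [leRHS](_ : _ = B * (e / (2 * (B + 1)))); last first.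
    by field; rewrite gt_eqF // ltr_wpDl.
  by rewrite ler_wpM2l // ltW.
have lt1 (C : R) : 0 <= C -> C / (C + 1) < 1 by move=> C0; rewrite ltr_pdivrMr; lra.
have e2 : 0 < e / 2 by rewrite divr_gt0.
have k1 : e / 2 * (A / (A + 1)) < e / 2 * 1 by rewrite ltr_pM2l // lt1.
have k2 : e / 2 * (B / (B + 1)) < e / 2 * 1 by rewrite ltr_pM2l // lt1.
move: h1 h2 k1 k2; lra.
Qed.

Lemma AC_id : abs_continuousI (@idfun R).
Proof.
move=> e e0; exists e => // m a b abI _.
by under eq_bigr => i _ do (rewrite -[b i - a i]ger0_norm; last by have := abI i; lra).
Qed.

Lemma AC_contI f : abs_continuousI f -> contI f.
Proof.
move=> fAC x /I11P xI; apply/cvgrPdist_lt => e e0.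
have [d d0 hd] := fAC e e0.
have key a b : -1 <= a -> a <= b -> b <= 1 -> b - a < d -> `|f b - f a| < e.
  move=> a1 ab b1 abd; have := hd 1%N (fun=> a) (fun=> b).
  rewrite !big_ord1; apply => //.
  by apply/trivIsetP => i j _ _; rewrite !ord1 eqxx.
exists d => //= y /=; rewrite ltr_norml => yx /I11P yI.
by have [xy|yx'] := leP x y; [rewrite distrC|]; apply: key; lra.
Qed.

Lemma AC_bounded f : abs_continuousI f ->
  exists2 C, 0 <= C & forall x, I11 x -> `|f x| <= C.
Proof. by move=> /AC_contI; exact: contI_bounded. Qed.

Lemma AC_D f g : abs_continuousI f -> abs_continuousI g ->
  abs_continuousI (fun x => f x + g x).
Proof.
move=> fAC gAC; apply: (AC_dominated fAC gAC ler01 ler01) => a b _ _.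
by rewrite !mul1r opprD addrACA ler_normD.
Qed.

Lemma AC_Z c f : abs_continuousI f -> abs_continuousI (fun x => c * f x).
Proof.
move=> fAC; apply: (AC_dominated fAC fAC (normr_ge0 c) (lexx 0)) => a b _ _.
by rewrite mul0r addr0 -mulrBr normrM.
Qed.

Lemma AC_M f g : abs_continuousI f -> abs_continuousI g ->
  abs_continuousI (fun x => f x * g x).
Proof.
move=> fAC gAC; have [F F0 fF] := AC_bounded fAC; have [G G0 gG] := AC_bounded gAC.
apply: (AC_dominated fAC gAC G0 F0) => a b aI bI.
rewrite (_ : _ - _ = (f b - f a) * g b + f a * (g b - g a)); last by ring.
rewrite (le_trans (ler_normD _ _)) // !normrM lerD //.
  by rewrite mulrC ler_wpM2r // gG.
by rewrite ler_wpM2r // fF.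
Qed.

Lemma C1_AC F g : (forall x, I11 x -> has_deriv F x (g x)) -> contI g ->
  abs_continuousI F.
Proof.
move=> dF cg; have [C C0 hC] := deriv_lipschitz dF cg.
apply: (AC_dominated AC_id AC_id C0 (lexx 0)) => a b /I11P aI /I11P bI /=.
rewrite mul0r addr0; have [ab|ba] := leP a b.
  by rewrite (ger0_norm (_ : 0 <= b - a)); [apply: hC; lra|lra].
rewrite distrC (distrC b) (ger0_norm (_ : 0 <= a - b)); last lra.
by apply: hC; lra.
Qed.

(** [j] derivatives on [-1, 1], the last of them absolutely continuous. In this
    recursive form the Leibniz rule shows by induction that the class is an
    algebra. *)
Fixpoint ACn j f : Prop :=
  if j is j'.+1 then (forall x, I11 x -> derivableI f x) /\ ACn j' (derivI f)
  else abs_continuousI f.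

Lemma derivI_ext f g : (forall x, I11 x -> f x = g x) ->
  (forall x, I11 x -> derivableI f x) ->
  (forall x, I11 x -> derivableI g x /\ derivI f x = derivI g x).
Proof.
move=> fg df x xI.
have /(has_deriv_ext fg xI)/(has_derivP _ _ xI) [dg <-] := has_deriv_derivI (df x xI).
by [].
Qed.

Lemma ACn_ext j f g : (forall x, I11 x -> f x = g x) -> ACn j f -> ACn j g.
Proof.
elim: j f g => [|j IH] f g fg; first exact: AC_ext.
move=> [df ACf]; have H := derivI_ext fg df; split; first by move=> x /H[].
by apply: IH ACf => x /H[].
Qed.

Lemma ACn_AC j f : ACn j f -> abs_continuousI f.
Proof.
elim: j f => [//|j IH] f [df /IH/AC_contI cf].
by apply: C1_AC cf => x xI; exact: has_deriv_derivI (df x xI).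
Qed.

Lemma ACnW j f : ACn j.+1 f -> ACn j f.
Proof.
elim: j f => [|j IH] f; first exact: ACn_AC.
by case=> df /IH ACf; split.
Qed.

Lemma ACn_le i j f : (i <= j)%N -> ACn j f -> ACn i f.
Proof.
move=> /subnK <-; elim: (j - i)%N => [//|k IH]; rewrite addSn => /ACnW; exact: IH.
Qed.

Lemma ACn_deriv j f (df : R -> R) : (forall x, I11 x -> has_deriv f x (df x)) ->
  ACn j df -> ACn j.+1 f.
Proof.
move=> hf ACdf; split; first by move=> x xI; apply/cvg_ex; exists (df x); exact: hf.
by apply: ACn_ext ACdf => x xI; have /(has_derivP _ _ xI) [_ ->] := hf x xI.
Qed.

Lemma ACn_D j f g : ACn j f -> ACn j g -> ACn j (fun x => f x + g x).
Proof.
elim: j f g => [|j IH] f g; first exact: AC_D.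
move=> [df ACf] [dg ACg]; apply: (ACn_deriv _ (IH _ _ ACf ACg)) => x xI.
by apply: has_derivD; apply: has_deriv_derivI; [exact: df|exact: dg].
Qed.

Lemma ACn_Z j c f : ACn j f -> ACn j (fun x => c * f x).
Proof.
elim: j f => [|j IH] f; first exact: AC_Z.
move=> [df ACf]; apply: (ACn_deriv _ (IH _ ACf)) => x xI.
by apply: has_deriv_scale; apply: has_deriv_derivI; exact: df.
Qed.

Lemma ACn_M j f g : ACn j f -> ACn j g -> ACn j (fun x => f x * g x).
Proof.
elim: j f g => [|j IH] f g; first exact: AC_M.
move=> ACf ACg; have [df ACdf] := ACf; have [dg ACdg] := ACg.
apply: (ACn_deriv _ (ACn_D (IH _ _ ACdf (ACnW ACg)) (IH _ _ (ACnW ACf) ACdg))).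
by move=> x xI; apply: has_derivM; apply: has_deriv_derivI; [exact: df|exact: dg].
Qed.

Lemma classC_AC_ACn q f : classC q f -> abs_continuousI (derivnI q f) -> ACn q f.
Proof.
elim: q f => [//|q IH] f [df cf] ACf; split; first by move=> x; exact: (df 0%N).
apply: IH; last by rewrite /derivnI -iterSr.
split=> [k x kq xI|k kq]; rewrite /derivnI -iterSr.
  by apply: (df k.+1).
by apply: (cf k.+1).
Qed.

(** The derivative of order [q] is Lipschitz, as it has a continuous
    derivative. *)
Lemma classC_ACn q f : classC q.+1 f -> ACn q f.
Proof.
move=> [df cf]; apply: classC_AC_ACn.
  by split=> [k x kq xI|k kq]; [apply: df => //; exact: ltnW|apply: cf; exact: leqW].
apply: (@C1_AC _ (derivnI q.+1 f)); last by apply/contIP; exact: cf.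
by move=> x xI; exact: has_deriv_derivI (df q x (ltnSn q) xI).
Qed.

End OneSidedCalculus.

(** * Riemann-Lebesgue lemma for Stieltjes integrals *)

Section Oscillation.
Variable R : realType.
Implicit Types (f g h u w du : R -> R) (a b x : R).

(** Summation by parts: on a cell, the difference between [du h] and its
    discrete counterpart is the integral of [du (h - h t)], [t] being the right
    end. *)
Lemma stieltjes_parts u du h M (D delta : R) : (0 < M)%N ->
  (forall x, I11 x -> has_deriv u x (du x)) -> contI du -> contI h ->
  (forall x, I11 x -> `|du x| <= D) ->
  (forall a b, -1 <= a -> a <= b -> b <= 1 -> b - a <= 2 / M%:R ->
     `|h b - h a| <= delta) ->
  `|integ (fun x => du x * h x) (-1) 1 - (u 1 * h 1 - u (-1) * h (-1))
    + \sum_(0 <= i < M) u (node R M i) * incr h M i| <= 2 * D * delta.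
Proof.
move=> M0 ud cdu ch duD hosc.
have -> : integ (fun x => du x * h x) (-1) 1 = \sum_(0 <= i < M)
    integ (fun x => du x * h x) (node R M i) (node R M i.+1).
  have := integ_nodes (contIM cdu ch) (leqnn (0 + M)%N).
  by rewrite !add0n node0 node_last // => <-.
have -> : u 1 * h 1 - u (-1) * h (-1) = \sum_(0 <= i < M)
    (u (node R M i.+1) * h (node R M i.+1) - u (node R M i) * h (node R M i)).
  by rewrite (telescope_sumr (fun i => u (node R M i) * h (node R M i))) //
    node0 node_last.
rewrite -sumrB -big_split /=.
have -> : 2 * D * delta = \sum_(0 <= i < M) (D * delta * (2 / M%:R)).
  rewrite big_const_nat subn0 iter_addr_0 -[RHS]mulr_natr.
  by rewrite -!mulrA mulVf ?pnatr_eq0 -?lt0n //; ring.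
rewrite (le_trans (ler_norm_sum _ _ _)) // big_nat [leRHS]big_nat.
apply: ler_sum => i /= iM.
set s := node R M i; set t := node R M i.+1.
have st : s <= t by apply: node_le.
have s1 : -1 <= s by apply: node_ge.
have t1 : t <= 1 by apply: node_le1.
have -> : integ (fun x => du x * h x) s t - (u t * h t - u s * h s) +
    u s * incr h M i = integ (fun x => du x * h x - h t * du x) s t.
  rewrite integB ?integZ //; last 2 first.
    exact: contIM. exact: contIZ.
  by rewrite (integ_deriv ud cdu) // /incr -/s -/t; ring.
rewrite -(nodeS R M i); apply: integ_norm_le => //.
  by apply: contIB; [exact: contIM|exact: contIZ].
move=> x /andP[sx xt].
have -> : du x * h x - h t * du x = du x * (h x - h t) by ring.
rewrite normrM ler_pM // ?duD //; first by apply/I11P; lra.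
rewrite distrC hosc //; first lra.
by have := nodeS R M i; rewrite -/s -/t; lra.
Qed.

(** The increments of [h] are replaced by their block means, at cost [B * e],
    which turns the left sum of each block into a Riemann sum of [u]. *)
Lemma left_sum_block u du h L K (B D e V : R) : (0 < L)%N -> (0 < K)%N ->
  (forall x, I11 x -> has_deriv u x (du x)) -> contI du ->
  (forall x, I11 x -> `|u x| <= B) -> 
  (forall a b, -1 <= a -> a <= b -> b <= 1 -> `|u b - u a| <= D * (b - a)) ->
  0 <= D ->
  \sum_(0 <= b < L) \sum_(0 <= i < K)
      `|incr h (L * K) (b * K + i) - incr h L b / K%:R| <= e ->
  \sum_(0 <= b < L) `|incr h L b| <= V ->
  `|\sum_(0 <= i < L * K) u (node R (L * K) i) * incr h (L * K) i
   - \sum_(0 <= b < L) incr h L b * (L%:R / 2) *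
       integ u (node R L b) (node R L b.+1)| <= B * e + V * (D * (2 / (L * K)%:R)).
Proof.
move=> L0 K0 ud cdu uB uD D0 he hV.
have LK0 : (0 < L * K)%N by rewrite muln_gt0 L0.
have cu : contI u := has_deriv_contI ud.
have LN : L%:R != 0 :> R by rewrite pnatr_eq0 -lt0n.
have KN : K%:R != 0 :> R by rewrite pnatr_eq0 -lt0n.
have idx (b i : nat) : (b < L)%N -> (i < K)%N -> (b * K + i < L * K)%N.
  by move=> bL iK; rewrite (@leq_trans (b.+1 * K)) ?leq_pmul2r // mulSn addnC ltn_add2r.
rewrite big_nat_block.
have -> : \sum_(0 <= b < L) incr h L b * (L%:R / 2) *
       integ u (node R L b) (node R L b.+1) =
   \sum_(0 <= b < L) \sum_(0 <= i < K) incr h L b * (L%:R / 2) *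
       integ u (node R (L * K) (b * K + i)) (node R (L * K) (b * K + i).+1).
  rewrite big_nat [RHS]big_nat; apply: eq_bigr => b /= bL.
  rewrite -mulr_sumr integ_nodes //; last by rewrite -mulSnr leq_pmul2r.
  by rewrite -mulSnr !node_block.
rewrite -sumrB; under eq_bigr do rewrite -sumrB.
set d : R := 2 / (L * K)%:R.
have d0 : 0 < d by rewrite divr_gt0 // ltr0n.
apply: (@le_trans _ _ (\sum_(0 <= b < L) \sum_(0 <= i < K)
   (B * `|incr h (L * K) (b * K + i) - incr h L b / K%:R| +
    `|incr h L b| / K%:R * (D * d)))); last first.
  under eq_bigr do rewrite big_split /=.
  rewrite big_split /= lerD //.
    under eq_bigr do rewrite -mulr_sumr.
    rewrite -mulr_sumr ler_wpM2l //.
    by rewrite (le_trans (normr_ge0 (u 1))) // uB //; exact: I11_1.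
  rewrite (eq_bigr (fun b : nat => `|incr h L b| * (D * d))) => [|b _]; last first.
    rewrite big_const_nat subn0 iter_addr_0 -[LHS]mulr_natr.
    by field.
  by rewrite -mulr_suml ler_wpM2r // mulr_ge0 // ltW.
rewrite (le_trans (ler_norm_sum _ _ _)) // big_nat [leRHS]big_nat.
apply: ler_sum => b /= bL.
apply: (le_trans (ler_norm_sum _ _ _)).
rewrite [leLHS]big_nat [leRHS]big_nat; apply: ler_sum => i /= iK.
set s := node R (L * K) _; set t := node R (L * K) _.+1.
have st : t - s = d by apply: nodeS.
have s1 : -1 <= s by apply: node_ge.
have t1 : t <= 1 by apply: node_le1; exact: idx.
have -> : u s * incr h (L * K) (b * K + i) - incr h L b * (L%:R / 2) * integ u s t =
  u s * (incr h (L * K) (b * K + i) - incr h L b / K%:R) +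
  incr h L b / K%:R * (integ (fun x => u s - u x) s t / d).
  rewrite integB ?integ_cst ?st //; [|lra|exact: contI_cst].
  rewrite /d natrM; field.
  by rewrite KN LN.
rewrite (le_trans (ler_normD _ _)) // !normrM lerD //.
  by rewrite ler_wpM2r // uB //; apply/I11P; lra.
rewrite [X in _ * X * _]ger0_norm ?invr_ge0 // ler_wpM2l //.
rewrite [X in _ * X]ger0_norm ?invr_ge0 ?(ltW d0) // ler_pdivrMr // -{2}st.
apply: integ_norm_le => //; [|lra|].
  by apply: contIB => //; exact: contI_cst.
move=> x /andP[sx xt]; rewrite distrC (le_trans (uD _ _ _ _ _)) //; [lra|].
by rewrite ler_wpM2l //; lra.
Qed.

(** [h] enters only through the partition into [L] blocks, on which the
    increments of [h] are spread evenly. The refinement by [K], used in the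
    proof to reach the Stieltjes integral, may depend on [u] and disappears. *)
Lemma stieltjes_estimate u du h L (B e : R) : abs_continuousI h ->
  (forall x, I11 x -> has_deriv u x (du x)) -> contI du ->
  (forall x, I11 x -> `|u x| <= B) -> (0 < L)%N -> 0 < e ->
  (forall K, (0 < K)%N -> \sum_(0 <= b < L) \sum_(0 <= i < K)
      `|incr h (L * K) (b * K + i) - incr h L b / K%:R| <= e) ->
  `|integ (fun x => du x * h x) (-1) 1 - (u 1 * h 1 - u (-1) * h (-1))| <=
  (B + 1) * e + \sum_(0 <= b < L) `|incr h L b| * (L%:R / 2) *
       `|integ u (node R L b) (node R L b.+1)|.
Proof.
move=> hAC ud cdu uB L0 e0 he.
have [D D0 duD] := contI_bounded cdu.
have [V V0 hV] := AC_variation hAC.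
have uD a b : -1 <= a -> a <= b -> b <= 1 -> `|u b - u a| <= D * (b - a).
  move=> a1 ab b1; rewrite -(integ_deriv ud cdu) //; apply: integ_norm_le => //.
  by move=> x xab; apply: duD; apply/I11P; lra.
have del0 : 0 < e / (4 * (D + 1)) by rewrite divr_gt0 // mulr_gt0 // ltr_wpDl.
have [d d0 hd] := hAC _ del0.
(* cells shorter than d, and a Riemann sum error V * D * (2 / (L * K)) <= e / 2 *)
pose K := (Num.truncn (2 / d + 4 * V * D / e)).+1.
have K0 : (0 < K)%N by [].
have hK : 2 / d + 4 * V * D / e < (L * K)%:R.
  rewrite (lt_le_trans (truncnS_gt _)) // ler_nat; exact: leq_pmull.
have LK0 : (0 < L * K)%N by rewrite muln_gt0 L0.
have LKR : 0 < (L * K)%:R :> R by rewrite ltr0n.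
have VD0 : 0 <= 4 * V * D / e by rewrite divr_ge0 ?mulr_ge0 // ltW.
have dd0 : 0 < 2 / d by rewrite divr_gt0.
have small1 : 2 / (L * K)%:R < d.
  by rewrite ltr_pdivrMr // mulrC -ltr_pdivrMr //; lra.
have small2 : V * (D * (2 / (L * K)%:R)) <= e / 2.
  rewrite !mulrA ler_pdivrMr //.
  have : 4 * V * D / e <= (L * K)%:R by lra.
  by rewrite ler_pdivrMr //; lra.
have hosc a b : -1 <= a -> a <= b -> b <= 1 -> b - a <= 2 / (L * K)%:R ->
     `|h b - h a| <= e / (4 * (D + 1)).
  move=> a1 ab b1 abd; have := hd 1%N (fun=> a) (fun=> b); rewrite !big_ord1 => H.
  apply/ltW/H => //; last exact: le_lt_trans small1.
  by apply/trivIsetP => i j _ _; rewrite !ord1 eqxx.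
have H1 := stieltjes_parts LK0 ud cdu (AC_contI hAC) duD hosc.
have H2 := left_sum_block L0 K0 ud cdu uB uD D0 (he _ K0) (hV _ L0).
have H3 : 2 * D * (e / (4 * (D + 1))) <= e / 2.
  rewrite (_ : 2 * D * _ = e / 2 * (D / (D + 1))); last by field; lra.
  rewrite -[leRHS]mulr1 ler_wpM2l ?divr_ge0 ?(ltW e0) // ler_pdivrMr; lra.
have H4 : `|\sum_(0 <= b < L) incr h L b * (L%:R / 2) *
       integ u (node R L b) (node R L b.+1)| <=
   \sum_(0 <= b < L) `|incr h L b| * (L%:R / 2) *
       `|integ u (node R L b) (node R L b.+1)|.
  rewrite (le_trans (ler_norm_sum _ _ _)) //; apply: ler_sum => b _.
  by rewrite normrM [X in X * _]normrM (ger0_norm (_ : 0 <= L%:R / 2)) // divr_ge0.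
move: H1 H2 H4; set I := integ _ _ _ - _; set S := \sum_(0 <= i < L * K) _.
set T := \sum_(0 <= b < L) incr _ _ _ * _ * _ => H1 H2 H4.
have : `|I| <= `|I + S| + `|S - T| + `|T|.
  rewrite (_ : I = (I + S) - (S - T) - T); last by ring.
  rewrite (_ : I + S - (S - T) - T + S = I + S); last by ring.
  by rewrite (le_trans (ler_normB _ _)) // lerD2r ler_normB.
by move=> HI; move: (le_trans HI (lerD (lerD H1 H2) H4)); lra.
Qed.

Lemma cvg0_sum (F : nat -> nat -> R) L :
  (forall i, (i < L)%N -> F i N @[N --> \oo] --> (0 : R)) ->
  \sum_(0 <= i < L) F i N @[N --> \oo] --> (0 : R).
Proof.
elim: L => [|L IH] F0.
  rewrite [X in X @ _](_ : _ = fun=> 0); first exact: cvg_cst.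
  by apply/funext => N; rewrite big_geq.
rewrite [X in X @ _](_ : _ = fun N => \sum_(0 <= i < L) F i N + F L N); last first.
  by apply/funext => N; rewrite big_nat_recr.
rewrite -[X in _ --> X]addr0; apply: cvgD; last exact: F0.
by apply: IH => i iL; apply: F0; exact: leqW.
Qed.

(** First [L] is fixed by the accuracy; then the finitely many integrals of [u
    N] over the blocks tend to 0. *)
Lemma stieltjes_cvg0 (u du : nat -> R -> R) h B : abs_continuousI h ->
  (forall N x, I11 x -> has_deriv (u N) x (du N x)) -> (forall N, contI (du N)) ->
  (\forall N \near \oo, forall x, I11 x -> `|u N x| <= B) ->
  (forall a b, -1 <= a -> a <= b -> b <= 1 ->
     integ (u N) a b @[N --> \oo] --> (0 : R)) ->
  integ (fun x => du N x * h x) (-1) 1 - (u N 1 * h 1 - u N (-1) * h (-1))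
    @[N --> \oo] --> (0 : R).
Proof.
move=> hAC ud cdu uB u0; apply/cvgr0Pnorm_le => e e0.
have B1 : 0 < `|B| + 1 by rewrite ltr_wpDl.
have e1 : 0 < e / (2 * (`|B| + 1)) by rewrite divr_gt0 // mulr_gt0.
have [L L0 hL] := AC_uniform_refinement hAC e1.
have S0 : \sum_(0 <= b < L) `|incr h L b| * (L%:R / 2) *
       `|integ (u N) (node R L b) (node R L b.+1)| @[N --> \oo] --> (0 : R).
  apply: cvg0_sum => i iL.
  rewrite -[X in _ --> X](mulr0 (`|incr h L i| * (L%:R / 2))).
  apply: cvgM; first exact: cvg_cst.
  rewrite -(normr0 R); apply: cvg_norm; apply: u0.
  - exact: node_ge.
  - exact: node_le.
  - exact: node_le1.
have e2 : 0 < e / 2 by rewrite divr_gt0.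
move/cvgr0Pnorm_le : S0 => /(_ _ e2) S0.
near=> N.
have uBN : forall x, I11 x -> `|u N x| <= B by near: N.
have SN : `|\sum_(0 <= b < L) `|incr h L b| * (L%:R / 2) *
       `|integ (u N) (node R L b) (node R L b.+1)| | <= e / 2 by near: N.
have := stieltjes_estimate hAC (ud N) (cdu N) uBN L0 e1 hL.
move=> /le_trans; apply.
have hB : (B + 1) * (e / (2 * (`|B| + 1))) <= e / 2.
  rewrite [leRHS](_ : _ = (`|B| + 1) * (e / (2 * (`|B| + 1)))); last by field; lra.
  by rewrite ler_wpM2r ?(ltW e1) // lerD2r ler_norm.
have := le_trans (ler_norm _) SN; lra.
Unshelve. all: by end_near. Qed.

(** * Sequences of solutions with unbounded spectral parameter *)

Section Sequences.
(* The equation z' = (lam + pot) w is satisfied by each of the pairs (u2, u1)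
   and (- u1, u2) of components of a solution of the Dirac system. *)
Variables (lam : nat -> R) (pot : R -> R) (z w : nat -> R -> R) (B : R).
Hypothesis lam0 : (lam N)^-1 @[N --> \oo] --> (0 : R).
Hypothesis lamN0 : \forall N \near \oo, lam N != 0.
Hypothesis potAC : abs_continuousI pot.
Hypothesis zw : forall N x, I11 x -> has_deriv (z N) x ((lam N + pot x) * w N x).
Hypothesis cw : forall N, contI (w N).
Hypothesis zB : \forall N \near \oo, forall x, I11 x -> `|z N x| <= B.
Hypothesis wB : \forall N \near \oo, forall x, I11 x -> `|w N x| <= B.

Lemma contI_dz N : contI (fun x => (lam N + pot x) * w N x).
Proof.
apply: contIM => //; apply: contID; first exact: contI_cst.
exact: AC_contI.
Qed.

Lemma lam_integ N h a b : contI h -> -1 <= a -> b <= 1 ->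
  lam N * integ (fun x => w N x * h x) a b =
  integ (fun x => (lam N + pot x) * w N x * h x) a b -
  integ (fun x => w N x * (pot x * h x)) a b.
Proof.
move=> ch a1 b1; have cp := AC_contI potAC.
rewrite -integB //; last 2 first.
  by apply: contIM => //; exact: contI_dz.
  by apply: contIM => //; exact: contIM.
rewrite -integZ //; last exact: contIM.
by apply: eq_integ => x _; ring.
Qed.

Lemma bounded_div_lam (e : nat -> R) (C : R) :
  (\forall N \near \oo, `|lam N * e N| <= C) -> e N @[N --> \oo] --> (0 : R).
Proof.
move=> eC; apply/cvgr0Pnorm_le => d d0.
have C1 : 0 < d / (`|C| + 1) by rewrite divr_gt0 // ltr_wpDl.
move/cvgr0Pnorm_le : lam0 => /(_ _ C1) lamd.
near=> N.
have L0 : lam N != 0 by near: N.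
have -> : e N = (lam N)^-1 * (lam N * e N) by rewrite mulrA mulVf // mul1r.
have E : `|lam N * e N| <= C by near: N.
have E' : `|(lam N)^-1| <= d / (`|C| + 1) by near: N.
rewrite normrM (le_trans (ler_pM _ _ E' E)) // mulrAC ler_pdivrMr ?ltr_wpDl //.
rewrite ler_wpM2l ?(ltW d0) // (le_trans (ler_norm C)) // lerDl //.
Unshelve. all: by end_near. Qed.

(** [lam * integ w] is an increment of the bounded function [z], up to a
    bounded term. *)
Lemma integ_w_cvg0 a b : -1 <= a -> a <= b -> b <= 1 ->
  integ (w N) a b @[N --> \oo] --> (0 : R).
Proof.
move=> a1 ab b1; have cp := AC_contI potAC; have [P P0 pP] := contI_bounded cp.
apply: (@bounded_div_lam _ (B + B + B * P * (b - a))).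
near=> N.
have zBN : forall x, I11 x -> `|z N x| <= B by near: N.
have wBN : forall x, I11 x -> `|w N x| <= B by near: N.
have B0 : 0 <= B by apply: le_trans (wBN 1 (@I11_1 R)).
have aI : I11 a by apply/I11P; lra.
have bI : I11 b by apply/I11P; lra.
have := lam_integ N (@contI_cst R 1) a1 b1.
under eq_integ do rewrite mulr1.
move=> ->.
under [X in X - _]eq_integ do rewrite mulr1.
rewrite (integ_deriv (@zw N) (@contI_dz N)) //.
rewrite (le_trans (ler_normB _ _)) // lerD //.
  by rewrite (le_trans (ler_normB _ _)) // lerD // zBN.
apply: integ_norm_le => //.
  by apply: contIM => //; apply: contIM => //; exact: contI_cst.
move=> x /andP[ax xb]; have xI : I11 x by apply/I11P; lra.
by rewrite mulr1 normrM ler_pM // ?wBN // pP.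
Unshelve. all: by end_near. Qed.

(** The same reason as for [integ_w_cvg0], the increment of [z] being replaced
    by a Stieltjes integral that is bounded because it is convergent. *)
Lemma integ_dz_cvg0 h : abs_continuousI h ->
  integ (fun x => (lam N + pot x) * w N x * h x) (-1) 1
    - (z N 1 * h 1 - z N (-1) * h (-1)) @[N --> \oo] --> (0 : R) ->
  integ (fun x => w N x * h x) (-1) 1 @[N --> \oo] --> (0 : R).
Proof.
move=> hAC /cvgr0Pnorm_le /(_ _ ltr01) r1.
have ch := AC_contI hAC; have [H H0 hH] := contI_bounded ch.
have cp := AC_contI potAC; have [P P0 pP] := contI_bounded cp.
apply: (@bounded_div_lam _ (1 + (B * H + B * H) + B * (P * H) * 2)).
near=> N.
have zBN : forall x, I11 x -> `|z N x| <= B by near: N.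
have wBN : forall x, I11 x -> `|w N x| <= B by near: N.
have r1N : `|integ (fun x => (lam N + pot x) * w N x * h x) (-1) 1
    - (z N 1 * h 1 - z N (-1) * h (-1))| <= 1 by near: N.
rewrite lam_integ //.
have b1 : `|z N 1 * h 1 - z N (-1) * h (-1)| <= B * H + B * H.
  rewrite (le_trans (ler_normB _ _)) // !normrM.
  by rewrite lerD // ler_pM // ?zBN ?hH //; (exact: I11_1 || exact: I11_N1).
have b2 : `|integ (fun x => w N x * (pot x * h x)) (-1) 1| <= B * (P * H) * 2.
  have N11 : (-1 : R) <= 1 by lra.
  rewrite [leRHS](_ : _ = B * (P * H) * (1 - (-1))); last by ring.
  apply: integ_norm_le => //; first by apply: contIM => //; exact: contIM.
  move=> x xI1; have xI : I11 x by apply/I11P.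
  by rewrite !normrM ler_pM ?mulr_ge0 ?wBN // ler_pM // ?pP ?hH.
move: r1N b1 b2; set I := integ _ _ _; set J := _ - z _ _ * _; set K := integ _ _ _.
move=> r1N b1 b2; rewrite (_ : I - K = (I - J) + J - K); last by ring.
rewrite (le_trans (ler_normB _ _)) // lerD // (le_trans (ler_normD _ _)) // lerD //.
Unshelve. all: by end_near. Qed.

End Sequences.

End Oscillation.

(** * Integration by parts for the Dirac operator *)

Section DiracScalar.
Variable R : realType.
Implicit Types (p r f g h u w du : R -> R).

(** Green's identity, with the operator moved from the solution [u] to [h]. *)
Lemma dirac_parts (mu : R) p r u1 u2 h1 h2 dh1 dh2 :
  contI p -> contI r ->
  (forall x, I11 x -> has_deriv u2 x ((mu + p x) * u1 x)) ->
  (forall x, I11 x -> has_deriv u1 x (- ((mu + r x) * u2 x))) ->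
  (forall x, I11 x -> has_deriv h1 x (dh1 x)) ->
  (forall x, I11 x -> has_deriv h2 x (dh2 x)) ->
  contI dh1 -> contI dh2 ->
  mu * integ (fun x => u1 x * h1 x + u2 x * h2 x) (-1) 1 =
  (u2 1 * h1 1 - u1 1 * h2 1) - (u2 (-1) * h1 (-1) - u1 (-1) * h2 (-1)) +
  integ (fun x => u1 x * (dh2 x - p x * h1 x) + u2 x * (- dh1 x - r x * h2 x)) (-1) 1.
Proof.
move=> cp cr d2 d1 dh1P dh2P cdh1 cdh2.
have cu1 := has_deriv_contI d1; have cu2 := has_deriv_contI d2.
have ch1 := has_deriv_contI dh1P; have ch2 := has_deriv_contI dh2P.
have cmu f : contI f -> contI (fun x => mu + f x).
  by move=> cf; apply: contID => //; exact: contI_cst.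
pose G x := u2 x * h1 x - u1 x * h2 x.
pose dG x := ((mu + p x) * u1 x) * h1 x + u2 x * dh1 x
   + -1 * (- ((mu + r x) * u2 x) * h2 x + u1 x * dh2 x).
have GP x : I11 x -> has_deriv G x (dG x).
  move=> xI; apply: (@has_deriv_ext _ (fun y => u2 y * h1 y + -1 * (u1 y * h2 y))) => //.
    by move=> y _; rewrite /G mulN1r.
  apply: has_derivD; first by apply: has_derivM; [exact: d2|exact: dh1P].
  by apply: has_deriv_scale; apply: has_derivM; [exact: d1|exact: dh2P].
have cdG : contI dG.
  have cm := cmu _ cp; have cr' := cmu _ cr.
  apply: contID.
    by apply: contID; do ?apply: contIM => //.
  by apply: contIZ; apply: contID; do ?apply: contIM => //; apply: contIN; apply: contIM.
have N11 : (-1 : R) <= 1 by lra.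
have -> : (u2 1 * h1 1 - u1 1 * h2 1) - (u2 (-1) * h1 (-1) - u1 (-1) * h2 (-1)) =
  integ dG (-1) 1 by rewrite (integ_deriv GP cdG).
rewrite -integD // ?cdG //; last first.
  by apply: contID; apply: contIM => //; apply: contIB => //; try exact: contIM; exact: contIN.
rewrite -integZ //; last by apply: contID; exact: contIM.
by apply: eq_integ => x _; rewrite /dG; ring.
Qed.

(** What remains of Green's identity when [h] is merely absolutely continuous:
    the derivatives of [h] are hidden in two Stieltjes integrals, which tend to
    0. *)
Lemma dirac_remainder (mu : nat -> R) p r (u1 u2 : nat -> R -> R) h1 h2 B :
  (mu N)^-1 @[N --> \oo] --> (0 : R) ->
  (\forall N \near \oo, mu N != 0) ->
  abs_continuousI p -> abs_continuousI r ->
  (forall N x, I11 x -> has_deriv (u2 N) x ((mu N + p x) * u1 N x)) ->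
  (forall N x, I11 x -> has_deriv (u1 N) x (- ((mu N + r x) * u2 N x))) ->
  (\forall N \near \oo, forall x, I11 x -> `|u1 N x| <= B) ->
  (\forall N \near \oo, forall x, I11 x -> `|u2 N x| <= B) ->
  abs_continuousI h1 -> abs_continuousI h2 ->
  mu N * integ (fun x => u1 N x * h1 x + u2 N x * h2 x) (-1) 1 -
  ((u2 N 1 * h1 1 - u1 N 1 * h2 1) - (u2 N (-1) * h1 (-1) - u1 N (-1) * h2 (-1)))
   @[N --> \oo] --> (0 : R).
Proof.
move=> mu0 muN0 pAC rAC d2 d1 u1B u2B h1AC h2AC.
have cu1 N : contI (u1 N) := has_deriv_contI (@d1 N).
have cu2 N : contI (u2 N) := has_deriv_contI (@d2 N).
pose z1 N x := -1 * u1 N x.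
have dz1 N x : I11 x -> has_deriv (z1 N) x ((mu N + r x) * u2 N x).
  move=> xI; rewrite (_ : (mu N + r x) * u2 N x = -1 * - ((mu N + r x) * u2 N x)); last by ring.
  by apply: has_deriv_scale; exact: d1.
have z1B : \forall N \near \oo, forall x, I11 x -> `|z1 N x| <= B.
  by apply: filterS u1B => N H x /H; rewrite /z1 mulN1r normrN.
have cd2 N := @contI_dz _ mu p u1 pAC cu1 N.
have cz1 N := @contI_dz _ mu r u2 rAC cu2 N.
have iu1 a b : -1 <= a -> a <= b -> b <= 1 -> integ (u1 N) a b @[N --> \oo] --> (0 : R).
  by apply: (integ_w_cvg0 mu0 muN0 pAC d2 cu1 u2B u1B).
have iu2 a b : -1 <= a -> a <= b -> b <= 1 -> integ (u2 N) a b @[N --> \oo] --> (0 : R).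
  by apply: (integ_w_cvg0 mu0 muN0 rAC dz1 cu2 z1B u2B).
have iz1 a b : -1 <= a -> a <= b -> b <= 1 -> integ (z1 N) a b @[N --> \oo] --> (0 : R).
  move=> a1 ab b1; rewrite [X in X @ _](_ : _ = fun N => -1 * integ (u1 N) a b); last first.
    by apply/funext => N; rewrite -integZ.
  rewrite -(mulr0 (-1)); apply: cvgM; [exact: cvg_cst|exact: iu1].
pose T2 h N := integ (fun x => (mu N + p x) * u1 N x * h x) (-1) 1 -
  (u2 N 1 * h 1 - u2 N (-1) * h (-1)).
pose T1 h N := integ (fun x => (mu N + r x) * u2 N x * h x) (-1) 1 -
  (z1 N 1 * h 1 - z1 N (-1) * h (-1)).
have S2 h : abs_continuousI h -> T2 h N @[N --> \oo] --> (0 : R).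
  by move=> hAC; exact: stieltjes_cvg0 hAC d2 cd2 u2B iu2.
have S1 h : abs_continuousI h -> T1 h N @[N --> \oo] --> (0 : R).
  by move=> hAC; exact: stieltjes_cvg0 hAC dz1 cz1 z1B iz1.
have I1 h : abs_continuousI h -> integ (fun x => u1 N x * h x) (-1) 1 @[N --> \oo] --> (0 : R).
  by move=> hAC; apply: (integ_dz_cvg0 mu0 muN0 pAC cu1 u2B u1B hAC); exact: S2.
have I2 h : abs_continuousI h -> integ (fun x => u2 N x * h x) (-1) 1 @[N --> \oo] --> (0 : R).
  by move=> hAC; apply: (integ_dz_cvg0 mu0 muN0 rAC cu2 z1B u2B hAC); exact: S1.
have ch1 := AC_contI h1AC; have ch2 := AC_contI h2AC.
rewrite [X in X @ _](_ : _ = fun N => (T2 h1 N + T1 h2 N) -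
    (integ (fun x => u1 N x * (p x * h1 x)) (-1) 1 +
     integ (fun x => u2 N x * (r x * h2 x)) (-1) 1)); last first.
  apply/funext => N; rewrite integD //; [|exact: contIM|exact: contIM].
  by rewrite mulrDr (lam_integ _ pAC cu1) // (lam_integ _ rAC cu2) // /T1 /T2 /z1; ring.
rewrite -[X in _ --> X](subrr (0 : R)) -[X in _ --> X - _](addr0 (0 : R)).
rewrite -[X in _ --> _ - X](addr0 (0 : R)).
apply: cvgB; apply: cvgD; [exact: S2|exact: S1|apply: I1|apply: I2]; exact: AC_M.
Qed.

End DiracScalar.

Section DiracVector.
Variable R : realType.
Implicit Types (p r : R -> R) (y f : R -> 'cV[R]_2).

Lemma Dirac1E p r y x : comp1 (Dirac p r y) x = derivI (comp2 y) x - p x * comp1 y x.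
Proof.
rewrite /comp1 /comp2 /Dirac !mxE !big_ord_recl !big_ord0 /Jmx /Qmx !mxE /=.
by rewrite /bump /= !(mul0r, mul1r, add0r, addr0, mulr0n, mulr1n).
Qed.

Lemma Dirac2E p r y x : comp2 (Dirac p r y) x = - derivI (comp1 y) x - r x * comp2 y x.
Proof.
rewrite /comp1 /comp2 /Dirac !mxE !big_ord_recl !big_ord0 /Jmx /Qmx !mxE /=.
have -> : lift ord0 ord0 = 1 :> 'I_2 by apply/val_inj.
by rewrite !(mul0r, mul1r, mulN1r, add0r, addr0, mulr0n, mulr1n).
Qed.

Lemma inner2E y f : inner2 y f =
  integ (fun x => comp1 y x * comp1 f x + comp2 y x * comp2 f x) (-1) 1.
Proof.
apply: eq_Rintegral => x _; rewrite /dot2 !mxE !big_ord_recl big_ord0 !mxE addr0.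
by rewrite /comp1 /comp2; congr (_ * _ + _ * _); congr (_ _ _ _); apply/val_inj.
Qed.

Definition ACv j y := ACn j (comp1 y) /\ ACn j (comp2 y).

Lemma ACv_Dirac j p r y : ACn j p -> ACn j r -> ACv j.+1 y -> ACv j (Dirac p r y).
Proof.
move=> ACp ACr [[d1 AC1] [d2 AC2]].
have AC1' : ACn j (comp1 y) by apply: ACnW; split.
have AC2' : ACn j (comp2 y) by apply: ACnW; split.
split.
  apply: (@ACn_ext _ _ (fun x => derivI (comp2 y) x + -1 * (p x * comp1 y x))).
    by move=> x _; rewrite Dirac1E mulN1r.
  by apply: ACn_D => //; apply: ACn_Z; exact: ACn_M.
apply: (@ACn_ext _ _ (fun x => -1 * derivI (comp1 y) x + -1 * (r x * comp2 y x))).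
  by move=> x _; rewrite Dirac2E !mulN1r.
by apply: ACn_D => //; apply: ACn_Z => //; exact: ACn_M.
Qed.

Lemma ACv_iter q p r f k : ACn q.-1 p -> ACn q.-1 r -> ACv q f -> (k <= q)%N ->
  ACv (q - k) (iter k (Dirac p r) f).
Proof.
move=> ACp ACr ACf; elim: k => [|k IH] kq; first by rewrite subn0.
apply: ACv_Dirac.
- by apply: ACn_le ACp; lia.
- by apply: ACn_le ACr; lia.
- by rewrite subnSK //; apply: IH; exact: ltnW.
Qed.

Lemma eigen_deriv alpha beta p r mu y : is_eigenfunction alpha beta p r mu y ->
  (forall x, I11 x -> has_deriv (comp2 y) x ((mu + p x) * comp1 y x)) /\
  (forall x, I11 x -> has_deriv (comp1 y) x (- ((mu + r x) * comp2 y x))).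
Proof.
move=> [dy Ay _ _]; split=> x xI; have [d1 d2] := dy x xI.
  have := Dirac1E p r y x; rewrite /comp1 Ay // mxE => E.
  suff <- : derivI (comp2 y) x = (mu + p x) * y x 0 0 by exact: has_deriv_derivI.
  by rewrite mulrDl E subrK.
have := Dirac2E p r y x; rewrite /comp2 Ay // mxE => E.
suff <- : derivI (comp1 y) x = - ((mu + r x) * y x 1 0) by exact: has_deriv_derivI.
by rewrite mulrDl E; ring.
Qed.

End DiracVector.

(** * Expansion of the Fourier coefficients *)

Section Expansion.
Variables (R : realType) (q : nat) (alpha beta : R) (p r : R -> R).
Variables (f : R -> 'cV[R]_2) (lam : int -> R) (v : int -> R -> 'cV[R]_2).
Variables (kp km : int -> R).
Hypothesis ACp : ACn q.-1 p.
Hypothesis ACr : ACn q.-1 r.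
Hypothesis ACf : ACv q f.
Hypothesis hv_eig : forall i : int, is_eigenfunction alpha beta p r (lam i) (v i).
Hypothesis hkp : forall i : int, v i 1 = kp i *: col2 (cos beta) (- sin beta).
Hypothesis hkm : forall i : int, v i (-1) = km i *: col2 (cos alpha) (- sin alpha).

Definition dirac_coef (k : nat) (i : int) : R := inner2 (v i) (iter k (Dirac p r) f).

Definition boundary_term (k : nat) (i : int) : R :=
  kp i * gred p r f beta 1 k - km i * gred p r f alpha (-1) k.

(** At each end the boundary condition makes [v] a multiple of a fixed vector,
    and the bracket sees only the reduced boundary value. *)
Lemma bracket_boundary_term k i : let h := iter k (Dirac p r) f in
  (comp2 (v i) 1 * comp1 h 1 - comp1 (v i) 1 * comp2 h 1)
  - (comp2 (v i) (-1) * comp1 h (-1) - comp1 (v i) (-1) * comp2 h (-1)) = boundary_term k i.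
Proof.
move=> h; rewrite /boundary_term /gred -/h /comp1 /comp2 hkp hkm !mxE /=; ring.
Qed.

Lemma dirac_coef_step k i : (k < q)%N -> lam i * dirac_coef k i = boundary_term k i + dirac_coef k.+1 i.
Proof.
move=> kq; rewrite /dirac_coef !inner2E -bracket_boundary_term /=.
set h := iter k _ f.
have [] : ACv (q - k) h by apply: ACv_iter => //; exact: ltnW.
rewrite -subnSK // => -[dh1 ACh1] [dh2 ACh2].
have [d2 d1] := eigen_deriv (hv_eig i).
rewrite (@dirac_parts R (lam i) p r _ _ _ _ (derivI (comp1 h)) (derivI (comp2 h))) //.
- congr (_ + _); apply: eq_integ => x _.
  by rewrite Dirac1E Dirac2E.
- exact: AC_contI (ACn_AC ACp).
- exact: AC_contI (ACn_AC ACr).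
- exact: AC_contI (ACn_AC ACh1).
- exact: AC_contI (ACn_AC ACh2).
Qed.

(** The factor of [x^(q+1)] in the expansion that is not a boundary term. *)
Definition expansion_tail (i : int) : R := lam i * dirac_coef q i - boundary_term q i.

Lemma coef_expansion i : lam i != 0 ->
  dirac_coef 0 i = (lam i)^-1 * \sum_(k < q) (lam i)^-1 ^+ k * boundary_term k i +
    (lam i)^-1 ^+ q.+1 * (boundary_term q i + expansion_tail i).
Proof.
move=> l0; rewrite /expansion_tail [boundary_term q i + _]addrC subrK.
suff H m : (m <= q)%N -> dirac_coef 0 i =
    (lam i)^-1 * \sum_(k < m) (lam i)^-1 ^+ k * boundary_term k i + (lam i)^-1 ^+ m * dirac_coef m i.
  by rewrite {1}(H q (leqnn q)) exprSr; congr (_ + _); rewrite -mulrA mulKf.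
elim: m => [|m IH] mq; first by rewrite big_ord0 mulr0 add0r expr0 mul1r.
rewrite IH ?(ltnW mq) // big_ord_recr /= mulrDr -addrA; congr (_ + _).
have -> : dirac_coef m i = (lam i)^-1 * (boundary_term m i + dirac_coef m.+1 i).
  by rewrite -dirac_coef_step // mulKf.
by rewrite exprSr; ring.
Qed.

Lemma expansion_tail_cvg0 (m : nat -> int) (B : R) :
  (lam (m N))^-1 @[N --> \oo] --> (0 : R) ->
  (\forall N \near \oo, lam (m N) != 0) ->
  (\forall N \near \oo, forall x, I11 x -> `|v (m N) x 0 0| <= B) ->
  (\forall N \near \oo, forall x, I11 x -> `|v (m N) x 1 0| <= B) ->
  expansion_tail (m N) @[N --> \oo] --> (0 : R).
Proof.
move=> l0 lN0 v1B v2B.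
have := ACv_iter ACp ACr ACf (leqnn q); rewrite subnn => -[ACh1 ACh2].
have := @dirac_remainder R (fun N => lam (m N)) p r (fun N => comp1 (v (m N)))
  (fun N => comp2 (v (m N))) _ _ B l0 lN0 (ACn_AC ACp) (ACn_AC ACr)
  (fun N => (eigen_deriv (hv_eig (m N))).1) (fun N => (eigen_deriv (hv_eig (m N))).2)
  v1B v2B ACh1 ACh2.
apply: cvg_trans; apply: near_eq_cvg; near=> N.
by rewrite bracket_boundary_term -inner2E.
Unshelve. all: by end_near. Qed.

End Expansion.

(** * Stability of interpolation at separated nodes *)

Section Interpolation.
Variable R : realFieldType.

(** Newton's argument: [P = P(y) + (X - y) Q], where [Q] has degree one less
    and values at most [2 e / eta] at the remaining nodes. *)
Lemma poly_coef_bound (M eta : R) (q : nat) : 0 <= M -> 0 < eta ->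
  exists2 C, 0 <= C & forall (ys : seq R) (P : {poly R}) (e : R),
    size ys = q -> uniq ys -> (forall y, y \in ys -> `|y| <= M) ->
    {in ys &, forall y z, y != z -> eta <= `|y - z|} ->
    (size P <= q)%N -> (forall y, y \in ys -> `|P.[y]| <= e) ->
    forall k, `|P`_k| <= C * e.
Proof.
move=> M0 eta0; elim: q => [|q [C C0 IH]].
  exists 0 => // ys P e _ _ _ _; rewrite leqn0 size_poly_eq0 => /eqP -> _ k.
  by rewrite coef0 normr0 mul0r.
exists (1 + (1 + M) * (C * (2 / eta))).
  by rewrite addr_ge0 // mulr_ge0 ?addr_ge0 // mulr_ge0 // divr_ge0 // ltW.
move=> [//|y ys] P e [sys] /= /andP[yys uys] yM ysep sP Pe k.
have Py : `|P.[y]| <= e by apply: Pe; rewrite mem_head.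
have e0 : 0 <= e by apply: le_trans Py.
have /factor_theorem[Q PQ] : root (P - (P.[y])%:P) y.
  by rewrite rootE hornerD hornerN hornerC subrr.
have sQ : (size Q <= q)%N.
  have [->|Q0] := eqVneq Q 0; first by rewrite size_poly0.
  have : (size (Q * ('X - y%:P))%R <= q.+1)%N.
    rewrite -PQ (leq_trans (size_polyD _ _)) // geq_max sP size_polyN size_polyC.
    by case: (_ != 0).
  by rewrite size_Mmonic ?monicXsubC // size_XsubC addn2.
have Qe z : z \in ys -> `|Q.[z]| <= 2 / eta * e.
  move=> zys; have zy : z != y by apply: contraNneq yys => <-.
  have zin : z \in y :: ys by rewrite inE zys orbT.
  have zy0 : z - y != 0 by rewrite subr_eq0.
  have -> : Q.[z] = (P.[z] - P.[y]) / (z - y).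
    have : (P - (P.[y])%:P).[z] = (Q * ('X - y%:P)).[z] by rewrite PQ.
    by rewrite hornerM !hornerE => ->; rewrite mulfK.
  rewrite normrM normfV ler_pdivrMr ?normr_gt0 //.
  rewrite (le_trans (ler_normB _ _)) // (le_trans (lerD (Pe _ zin) Py)) //.
  rewrite (_ : e + e = 2 / eta * e * eta); last by field; rewrite gt_eqF.
  rewrite ler_wpM2l ?ysep ?mem_head //.
  by rewrite mulr_ge0 // divr_ge0 // ltW.
have Qk j : `|Q`_j| <= C * (2 / eta * e).
  apply: (IH ys) => // [z zys|z t zys tys].
    by apply: yM; rewrite inE zys orbT.
  by apply: ysep; rewrite inE ?zys ?tys orbT.
have -> : P = (P.[y])%:P + (Q * 'X - y *: Q).
  by rewrite -[LHS](subrK (P.[y])%:P) PQ addrC mulrBr [Q * y%:P]mulrC mul_polyC.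
rewrite coefD coefC coefB coefMX coefZ.
rewrite (_ : (1 + _) * e = e + (C * (2 / eta * e) + M * (C * (2 / eta * e)))); last by ring.
rewrite (le_trans (ler_normD _ _)) // lerD //.
  by case: ifP => // _; rewrite normr0.
rewrite (le_trans (ler_normB _ _)) // lerD //.
  case: ifP => // _; rewrite normr0 mulr_ge0 // mulr_ge0 // divr_ge0 //.
  exact: ltW.
by rewrite normrM ler_pM // yM // mem_head.
Qed.

Lemma prod_XsubC_coef_bound (rho : R) (zs : seq R) k : 0 <= rho ->
  (forall z, z \in zs -> `|z| <= rho) -> (k <= size zs)%N ->
  `|(\prod_(z <- zs) ('X - z%:P))`_k| <= 2 ^+ size zs * rho ^+ (size zs - k).
Proof.
move=> rho0; elim: zs k => [|z zs IH] k zr /=.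
  by rewrite leqn0 => /eqP ->; rewrite big_nil coef1 eqxx !expr0 mulr1 normr1.
move=> kz; rewrite big_cons mulrC mulrBr coefB coefMX coefMC.
have zr' t : t \in zs -> `|t| <= rho by move=> tz; apply: zr; rewrite inE tz orbT.
have zz : `|z| <= rho by apply: zr; rewrite mem_head.
rewrite (le_trans (ler_normB _ _)) // exprS -mulrA mulr2n mulrDl mul1r lerD //.
  case: k kz => [_|k kz] /=; last by rewrite subSS; exact: IH.
  by rewrite normr0 mulr_ge0 // exprn_ge0.
have [kz'|kz'] := leqP k (size zs).
  rewrite normrM subSn // exprSr mulrA ler_pM //; exact: IH.
rewrite nth_default ?mul0r ?normr0 ?mulr_ge0 ?exprn_ge0 //.
by rewrite size_prod_XsubC.
Qed.

(** With [kp = K] on [E], [kp = - K] on [O] and [km = K], the sums are values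
    of the polynomials with coefficients [K (a - b)] and [- K (a + b)], at [q]
    nodes each. Small deviations [d] of the scalars add at most half of the
    norm [T] of the unknowns, which is absorbed. *)
Lemma parity_stability (m q : nat) (M eta K : R) : 0 <= M -> 0 < eta -> 0 < K ->
  exists C d : R, [/\ 0 <= C, 0 < d & forall (y kp km : 'I_m -> R)
    (E O : {set 'I_m}) (a b : 'rV[R]_q) (e : R),
    #|E| = q -> #|O| = q -> (forall s, `|y s| <= M) ->
    {in E &, forall s t, s != t -> eta <= `|y s - y t|} ->
    {in O &, forall s t, s != t -> eta <= `|y s - y t|} ->
    (forall s, s \in E -> `|kp s - K| <= d) ->
    (forall s, s \in O -> `|kp s + K| <= d) ->
    (forall s, `|km s - K| <= d) ->
    (forall s, `|\sum_(k < q) y s ^+ k * (kp s * a 0 k - km s * b 0 k)| <= e) ->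
    forall k, `|a 0 k| <= C * e /\ `|b 0 k| <= C * e].
Proof.
move=> M0 eta0 K0; have [CN CN0 HN] := poly_coef_bound q M0 eta0.
pose MM := (1 + M) ^+ q.
have MM0 : 0 < MM by rewrite exprn_gt0 // ltr_pwDl.
have CN1 : 0 < CN + 1 by rewrite ltr_wpDl.
have q1 : 0 < q%:R + 1 :> R by rewrite ltr_wpDl.
(* with this d the deviations contribute at most T / 2 to the bound on T below *)
pose d := K / (4 * (q%:R + 1) * (CN + 1) * MM).
have d0 : 0 < d by rewrite divr_gt0 // !mulr_gt0.
exists (4 * q%:R * CN / K), d; split=> //.
  by rewrite divr_ge0 ?mulr_ge0 // ltW.
move=> y kp km E O a b e cE cO yM sepE sepO kpE kpO kmK He.
pose T := \sum_(k < q) (`|a 0 k| + `|b 0 k|).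
(* T is the l1 norm of the unknowns; pert replaces kp and km by their limits *)
have T0 : 0 <= T by rewrite sumr_ge0 // => k _; rewrite addr_ge0.
have yk s (k : 'I_q) : `|y s ^+ k| <= MM.
  rewrite normrX (@le_trans _ _ ((1 + M) ^+ k)) //.
    by rewrite lerXn2r ?nnegrE ?addr_ge0 // (le_trans (yM s)) // lerDr.
  by rewrite ler_weXn2l ?lerDl // ltnW.
have pert s (sg : R) : `|kp s - sg| <= d ->
    `|\sum_(k < q) y s ^+ k * (sg * a 0 k - K * b 0 k)| <= e + d * MM * T.
  move=> kps.
  have -> : \sum_(k < q) y s ^+ k * (sg * a 0 k - K * b 0 k) =
     \sum_(k < q) y s ^+ k * (kp s * a 0 k - km s * b 0 k) -
     \sum_(k < q) y s ^+ k * ((kp s - sg) * a 0 k - (km s - K) * b 0 k).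
    by rewrite -sumrB; apply: eq_bigr => k _; ring.
  rewrite (le_trans (ler_normB _ _)) // lerD // (le_trans (ler_norm_sum _ _ _)) //.
  rewrite /T mulr_sumr; apply: ler_sum => k _.
  rewrite normrM [d * MM]mulrC -mulrA ler_pM // mulrDr.
  rewrite (le_trans (ler_normB _ _)) // lerD // normrM ler_wpM2r //.
have nodes (A : {set 'I_m}) (w : 'rV[R]_q) e' : #|A| = q ->
    {in A &, forall s t, s != t -> eta <= `|y s - y t|} ->
    (forall s, s \in A -> `|\sum_(k < q) y s ^+ k * w 0 k| <= e') ->
    forall k, `|w 0 k| <= CN * e'.
  move=> cA sepA wA k.
  have -> : w 0 k = (rVpoly w)`_k by rewrite coef_rVpoly_ord.
  apply: (HN [seq y s | s <- enum A]).
  - by rewrite size_map -cardE.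
  - rewrite map_inj_in_uniq ?enum_uniq // => s t; rewrite !mem_enum => sA tA yst.
    apply/eqP; apply: contraT => st; have := sepA s t sA tA st.
    by rewrite yst subrr normr0 leNgt eta0.
  - by move=> _ /mapP[s _ ->].
  - move=> _ _ /mapP[s sA ->] /mapP[t tA ->] st; apply: sepA.
    + by rewrite -mem_enum.
    + by rewrite -mem_enum.
    + by apply: contraNneq st => ->.
  - exact: size_poly.
  - move=> _ /mapP[s sA ->]; rewrite (horner_coef_wide _ (size_poly _ _)).
    under eq_bigr do rewrite coef_rVpoly_ord mulrC.
    by apply: wA; rewrite -mem_enum.
have half (A : {set 'I_m}) (sg : R) : #|A| = q ->
    {in A &, forall s t, s != t -> eta <= `|y s - y t|} -> `|sg| = K ->
    (forall s, s \in A -> `|kp s - sg| <= d) ->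
    forall k, `|sg * a 0 k - K * b 0 k| <= CN * (e + d * MM * T).
  move=> cA sepA sgK kpA k.
  have := nodes A (sg *: a - K *: b) _ cA sepA _ k; rewrite !mxE; apply.
  move=> s sA; rewrite (eq_bigr (fun k : 'I_q => y s ^+ k * (sg * a 0 k - K * b 0 k))).
    by apply: pert; exact: kpA.
  by move=> j _; rewrite !mxE.
have hE := half E K cE sepE (gtr0_norm K0) kpE.
have hO : forall k, `|(- K) * a 0 k - K * b 0 k| <= CN * (e + d * MM * T).
  apply: (half O) => //; first by rewrite normrN gtr0_norm.
  by move=> s sO; rewrite opprK; exact: kpO.
set F := CN * (e + d * MM * T) in hE hO.
have ab k : `|a 0 k| <= F / K /\ `|b 0 k| <= F / K.
  rewrite !ler_pdivlMr //; split.
    rewrite -(gtr0_norm K0) -normrM.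
    rewrite (_ : a 0 k * K = ((K * a 0 k - K * b 0 k) - (- K * a 0 k - K * b 0 k)) / 2); last by field.
    rewrite normrM (ger0_norm (_ : 0 <= 2^-1)) // ler_pdivrMr //.
    by rewrite (le_trans (ler_normB _ _)) //; have := hE k; have := hO k; lra.
  rewrite -(gtr0_norm K0) -normrM.
  rewrite (_ : b 0 k * K = - ((K * a 0 k - K * b 0 k) + (- K * a 0 k - K * b 0 k)) / 2); last by field.
  rewrite normrM normrN (ger0_norm (_ : 0 <= 2^-1)) // ler_pdivrMr //.
  by rewrite (le_trans (ler_normD _ _)) //; have := hE k; have := hO k; lra.
have TF : T <= 2 * q%:R * (F / K).
  rewrite (_ : 2 * q%:R * (F / K) = \sum_(k < q) (F / K + F / K)); last first.
    by rewrite sumr_const card_ord -[RHS]mulr_natr; ring.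
  by apply: ler_sum => k _; have [? ?] := ab k; exact: lerD.
have q0 : 0 <= q%:R :> R by [].
have small : 2 * q%:R * (CN * (d * MM) / K) <= 1 / 2.
  rewrite /d (_ : 2 * _ * _ = 1 / 2 * (q%:R / (q%:R + 1)) * (CN / (CN + 1))); last first.
    by field; rewrite !gt_eqF.
  rewrite -mulrA -[leRHS]mulr1 ler_wpM2l // -[leRHS]mulr1 ler_pM ?divr_ge0 ?(ltW q1) ?(ltW CN1) //.
    by rewrite ler_pdivrMr //; lra.
  by rewrite ler_pdivrMr //; lra.
have TC : T <= 4 * q%:R * CN / K * e.
  have -> : 4 * q%:R * CN / K * e = 2 * (2 * q%:R * (CN * e / K)) by field; rewrite gt_eqF.
  have : 2 * q%:R * (F / K) = 2 * q%:R * (CN * e / K) + 2 * q%:R * (CN * (d * MM) / K) * T.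
    by rewrite /F; field; rewrite gt_eqF.
  have := ler_wpM2r T0 small; lra.
move=> k; have : `|a 0 k| + `|b 0 k| <= T.
  rewrite /T (bigD1 k) //= lerDl sumr_ge0 // => j _; exact: addr_ge0.
have := normr_ge0 (a 0 k); have := normr_ge0 (b 0 k); split; lra.
Qed.

End Interpolation.

Section LinearSystem.
Variables (R : realType) (q : nat).

Lemma square_system_solvable (F : fieldType) m n (A : 'M[F]_(m, n)) : m = n ->
  (forall u : 'rV_m, u *m A = 0 -> u = 0) -> forall w : 'rV_n, exists u, u *m A = w.
Proof.
move=> mn inj w; have /eqP rA : row_free A by apply: inj_row_free.
have fA : row_full A by rewrite /row_full rA mn.
by have /submxP[u ->] := submx_full w fA; exists u.
Qed.

(** As many equations as unknowns, so that injectivity suffices. *)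
Lemma keg_unique_solution (x c kp km : int -> R) (ns : 'I_(2 * q) -> int) :
  (forall a b : 'rV[R]_q, keg_system x (fun=> 0) kp km ns a b -> a = 0 /\ b = 0) ->
  exists! g : 'rV[R]_q * 'rV[R]_q, keg_system x c kp km ns g.1 g.2.
Proof.
move=> inj.
pose A : 'M[R]_(q + q, 2 * q) := col_mx
  (\matrix_(k < q, s < 2 * q) (x (ns s) * (x (ns s) ^+ k * kp (ns s))))
  (\matrix_(k < q, s < 2 * q) (x (ns s) * (x (ns s) ^+ k * - km (ns s)))).
have AE (d : int -> R) a b :
    keg_system x d kp km ns a b <-> row_mx a b *m A = \row_s d (ns s).
  have E s : (row_mx a b *m A) 0 s = x (ns s) *
      \sum_(k < q) x (ns s) ^+ k * (kp (ns s) * a 0 k - km (ns s) * b 0 k).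
    rewrite mul_row_col !mxE mulr_sumr -big_split /=; apply: eq_bigr => k _.
    by rewrite !mxE; ring.
  split=> [H|H s]; first by apply/rowP => s; rewrite E !mxE -H.
  by rewrite -E H mxE.
have qq : (q + q = 2 * q)%N by rewrite mul2n addnn.
have [|u uA] := square_system_solvable (A := A) qq _ (\row_s c (ns s)).
  move=> u uA; have [|a0 b0] := inj (lsubmx u) (rsubmx u).
    by apply/AE; rewrite hsubmxK uA; apply/rowP => s; rewrite !mxE.
  by rewrite -[u]hsubmxK a0 b0 row_mx0.
exists (lsubmx u, rsubmx u); split; first by apply/AE; rewrite /= hsubmxK.
move=> [a b] /= /AE abA.
have [] := inj (a - lsubmx u) (b - rsubmx u).
  apply/AE; rewrite -[row_mx _ _](_ : row_mx a b - u = _); last first.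
    by rewrite -{1}[u]hsubmxK opp_row_mx add_row_mx.
  by rewrite mulmxBl abA uA subrr; apply/rowP => s; rewrite !mxE.
by move=> /eqP; rewrite subr_eq0 => /eqP <- /eqP; rewrite subr_eq0 => /eqP <-.
Qed.

End LinearSystem.

(** * The polynomials of the main term *)

Section Polynomials.
Variables (R : realType) (q m : nat) (x : int -> R) (ns : 'I_m -> int).
Hypothesis cE : #|Eset ns| = q.
Hypothesis cO : #|Oset ns| = q.

Lemma prod_set_seq (A : {set 'I_m}) : \prod_(s in A) ('X - (x (ns s))%:P) =
  \prod_(z <- [seq x (ns s) | s <- enum A]) ('X - z%:P).
Proof. by rewrite big_map big_enum_cond /=; apply: eq_bigl => s; rewrite andbT. Qed.

Lemma prod_set_top (A : {set 'I_m}) : #|A| = q ->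
  (\prod_(s in A) ('X - (x (ns s))%:P))`_q = 1 /\
  size (\prod_(s in A) ('X - (x (ns s))%:P)) = q.+1.
Proof.
move=> cA; rewrite prod_set_seq; set zs := [seq _ | _ <- _].
have szs : size zs = q by rewrite size_map -cardE.
have := monic_prod_XsubC zs xpredT id => /monicP.
by rewrite lead_coefE size_prod_XsubC szs.
Qed.

Lemma prod_set_coef_bound (A : {set 'I_m}) (rho : R) k : #|A| = q -> (k <= q)%N ->
  (forall s, `|x (ns s)| <= rho) -> 0 <= rho ->
  `|(\prod_(s in A) ('X - (x (ns s))%:P))`_k| <= 2 ^+ q * rho ^+ (q - k).
Proof.
move=> cA kq xr rho0; rewrite prod_set_seq.
have szs : size [seq x (ns s) | s <- enum A] = q by rewrite size_map -cardE.
rewrite -szs; apply: prod_XsubC_coef_bound => //; last by rewrite szs.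
by move=> _ /mapP[s _ ->].
Qed.

Lemma Uplus_sum z :
  \sum_(k < q) z ^+ k * (Uplus x ns)`_k = 2^-1 * ((PiE x ns).[z] + (PiO x ns).[z]) - z ^+ q.
Proof.
have [tE sE] := prod_set_top cE; have [tO sO] := prod_set_top cO.
have E : (Uplus x ns).[z] = 2^-1 * ((PiE x ns).[z] + (PiO x ns).[z]).
  by rewrite /Uplus hornerZ hornerD.
rewrite -E (@horner_coef_wide _ q.+1) ?big_ord_recr /=; last first.
  rewrite (leq_trans (size_scale_leq _ _)) // (leq_trans (size_polyD _ _)) //.
  by rewrite geq_max sE sO leqnn.
rewrite [X in _ + X - _](_ : _ = z ^+ q); last first.
  by rewrite /Uplus coefZ coefD tE tO; field.
by rewrite addrK; apply: eq_bigr => k _; rewrite mulrC.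
Qed.

Lemma Uminus_sum z :
  \sum_(k < q) z ^+ k * (Uminus x ns)`_k = - (2^-1 * ((PiE x ns).[z] - (PiO x ns).[z])).
Proof.
have [tE sE] := prod_set_top cE; have [tO sO] := prod_set_top cO.
have E : (Uminus x ns).[z] = - (2^-1 * ((PiE x ns).[z] - (PiO x ns).[z])).
  by rewrite /Uminus hornerN hornerZ hornerD hornerN.
rewrite -E (@horner_coef_wide _ q.+1) ?big_ord_recr /=; last first.
  rewrite size_polyN (leq_trans (size_scale_leq _ _)) // (leq_trans (size_polyD _ _)) //.
  by rewrite size_polyN geq_max sE sO leqnn.
rewrite [X in _ + X](_ : _ = 0); last first.
  by rewrite /Uminus coefN coefZ coefB tE tO subrr mulr0 oppr0 mul0r.
by rewrite addr0; apply: eq_bigr => k _; rewrite mulrC.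
Qed.

Lemma PiE_root s : s \in Eset ns -> (PiE x ns).[x (ns s)] = 0.
Proof.
by move=> sE; rewrite /PiE horner_prod (bigD1 s) //= !hornerE subrr mul0r.
Qed.

Lemma PiO_root s : s \in Oset ns -> (PiO x ns).[x (ns s)] = 0.
Proof.
by move=> sO; rewrite /PiO horner_prod (bigD1 s) //= !hornerE subrr mul0r.
Qed.

Lemma prod_set_scaled (A : {set 'I_m}) (w z M : R) : #|A| = q ->
  (forall s, `|w * x (ns s)| <= M) -> `|w * z| <= M ->
  `|w ^+ q * (\prod_(s in A) ('X - (x (ns s))%:P)).[z]| <= (M + M) ^+ q.
Proof.
move=> cA wM wz; rewrite -cA -!prodr_const horner_prod -big_split /= normr_prod.
apply: ler_prod => s _; rewrite normr_ge0 /=.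
by rewrite !hornerE mulrBr (le_trans (ler_normB _ _)) // lerD.
Qed.

Lemma Eset_or_Oset s : s \in Eset ns \/ s \in Oset ns.
Proof. by rewrite !inE; case: (odd _); [right|left]. Qed.

(** Difference between [g] and its predicted value [G - a P - b Q], the
    coefficient of index [k] being multiplied by [w^(q-k)]: with [w = N],
    exactly what has to tend to 0. *)
Definition scaled_error (w : R) (g : 'rV[R]_q) (G : nat -> R) (a b : R)
    (P Q : {poly R}) : 'rV[R]_q :=
  \row_(k < q) (w ^+ (q - k) * (g 0 k - (G k - a * P`_k - b * Q`_k))).

(** The scaled errors solve a perturbed homogeneous system. At a root of [PiE]
    both [Uplus] and [Uminus] reduce to half of [PiO], so that [PiO] is
    multiplied by [kp - km] only, which is small; at a root of [PiO] the factor
    of [PiE] is [kp + km]. *)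
Lemma keg_residual (kp km : R) (gp gm : 'rV[R]_q) (Gp Gm : nat -> R) (t w z M del : R) s :
  z = x (ns s) ->
  \sum_(k < q) z ^+ k * (kp * gp 0 k - km * gm 0 k) =
    \sum_(k < q) z ^+ k * (kp * Gp k - km * Gm k) + z ^+ q * (kp * Gp q - km * Gm q + t) ->
  0 < w -> (forall s, `|w * x (ns s)| <= M) -> `|t| <= del ->
  (s \in Eset ns -> `|kp - km| <= 2 * del) ->
  (s \in Oset ns -> `|kp + km| <= 2 * del) ->
  `|\sum_(k < q) (w * z) ^+ k *
     (kp * scaled_error w gp Gp (Gp q) (Gm q) (Uplus x ns) (Vplus x ns) 0 k -
      km * scaled_error w gm Gm (Gp q) (Gm q) (Uminus x ns) (Vminus x ns) 0 k)| <=
   del * (M ^+ q + (`|Gp q| + `|Gm q|) * (M + M) ^+ q).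
Proof.
move=> zE sys w0 wM tdel kE kO.
set A := scaled_error _ _ _ _ _ (Uplus x ns) _.
set B := scaled_error _ _ _ _ _ (Uminus x ns) _.
have M0 : 0 <= M by apply: le_trans (wM s).
have -> : \sum_(k < q) (w * z) ^+ k * (kp * A 0 k - km * B 0 k) =
  w ^+ q * (\sum_(k < q) z ^+ k * (kp * gp 0 k - km * gm 0 k) -
    \sum_(k < q) z ^+ k * (kp * Gp k - km * Gm k) +
    (kp * Gp q - km * Gm q) * \sum_(k < q) z ^+ k * (Uplus x ns)`_k +
    (kp * Gm q - km * Gp q) * \sum_(k < q) z ^+ k * (Uminus x ns)`_k).
  rewrite !mulr_sumr -sumrB -!big_split /= mulr_sumr; apply: eq_bigr => k _.
  have wq : w ^+ q = w ^+ (q - k) * w ^+ k by rewrite -exprD subnK // ltnW.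
  by rewrite /A /B !mxE /Vplus /Vminus exprMn wq; ring.
rewrite sys Uplus_sum Uminus_sum.
have -> : w ^+ q * (\sum_(k < q) z ^+ k * (kp * Gp k - km * Gm k) +
     z ^+ q * (kp * Gp q - km * Gm q + t) -
     \sum_(k < q) z ^+ k * (kp * Gp k - km * Gm k) +
     (kp * Gp q - km * Gm q) * (2^-1 * ((PiE x ns).[z] + (PiO x ns).[z]) - z ^+ q) +
     (kp * Gm q - km * Gp q) * - (2^-1 * ((PiE x ns).[z] - (PiO x ns).[z]))) =
  t * (w * z) ^+ q +
  2^-1 * ((Gp q - Gm q) * ((kp + km) * (w ^+ q * (PiE x ns).[z])) +
   (Gp q + Gm q) * ((kp - km) * (w ^+ q * (PiO x ns).[z]))).
  rewrite exprMn; ring.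
have bE : `|w ^+ q * (PiE x ns).[z]| <= (M + M) ^+ q.
  by apply: prod_set_scaled => //; rewrite zE.
have bO : `|w ^+ q * (PiO x ns).[z]| <= (M + M) ^+ q.
  by apply: prod_set_scaled => //; rewrite zE.
have MM0 : 0 <= (M + M) ^+ q by rewrite exprn_ge0 // addr_ge0.
apply: (le_trans (ler_normD _ _)); rewrite [leRHS]mulrDr lerD //.
  rewrite normrM ler_pM // normrX lerXn2r ?nnegrE //.
  by rewrite zE.
have del0 : 0 <= del by apply: le_trans tdel.
case: (Eset_or_Oset s) => sA.
  rewrite {1}zE PiE_root // !mulr0 add0r !normrM (ger0_norm (_ : 0 <= 2^-1)) //.
  rewrite (_ : del * _ = 2^-1 * ((`|Gp q| + `|Gm q|) * (2 * del * (M + M) ^+ q))); last by field.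
  rewrite ler_wpM2l // ler_pM ?ler_normD ?mulr_ge0 // ler_pM //; first exact: kE.
  by rewrite -normrM.
rewrite {2}zE PiO_root // !mulr0 addr0 !normrM (ger0_norm (_ : 0 <= 2^-1)) //.
rewrite (_ : del * _ = 2^-1 * ((`|Gp q| + `|Gm q|) * (2 * del * (M + M) ^+ q))); last by field.
rewrite ler_wpM2l // ler_pM ?ler_normB ?mulr_ge0 // ler_pM //; first exact: kO.
by rewrite -normrM.
Qed.

End Polynomials.

(** * Asymptotics of the eigendata *)

Section Limits.
Variable R : realType.

Lemma unif_bigO_small (e : int -> R -> R) (m : nat -> int) (eps : R) :
  unif_bigO_inv e -> (forall n0 : nat, \forall N \near \oo, (n0 <= `|m N|)%N) ->
  0 < eps -> \forall N \near \oo, forall x, I11 x -> `|e (m N) x| <= eps.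
Proof.
move=> [C [n0 He]] hm eps0.
pose n1 := (Num.truncn (`|C| / eps)).+1.
near=> N => x xI.
have N0 : (n0 <= `|m N|)%N by near: N; exact: hm.
have N1 : (n1 <= `|m N|)%N by near: N; exact: hm.
rewrite (le_trans (He _ N0 _ xI)) //.
have mR : `|C| / eps < (`|m N|%:~R : R).
  rewrite -abszE (lt_le_trans (truncnS_gt _)) // -pmulrn ler_nat //.
have m0 : 0 < (`|m N|%:~R : R) by rewrite (le_lt_trans _ mR) // divr_ge0 // ltW.
rewrite ler_pdivrMr // (le_trans (ler_norm C)) //.
by rewrite mulrC -ler_pdivrMr // ltW.
Unshelve. all: by end_near. Qed.

Lemma bigO_cvg0 (e : int -> R) (m : nat -> int) : bigO_inv e ->
  (forall n0 : nat, \forall N \near \oo, (n0 <= `|m N|)%N) ->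
  e (m N) @[N --> \oo] --> (0 : R).
Proof.
move=> [C [n0 He]] hm; apply/cvgr0Pnorm_le => eps eps0.
have U : unif_bigO_inv (fun i (_ : R) => e i) by exists C, n0 => i /He.
have := unif_bigO_small U hm eps0.
by apply: filterS => N /(_ 1 (@I11_1 R)).
Qed.

Lemma cos_int_pi (i : int) (t : R) : cos (pi * i%:~R + t) = (-1) ^+ odd `|i| * cos t.
Proof.
have nat_case (n : nat) u : cos (pi * n%:R + u) = (-1) ^+ odd n * cos u :> R.
  elim: n u => [|n IH] u; first by rewrite mulr0 add0r expr0 mul1r.
  have -> : pi * n.+1%:R + u = (pi * n%:R + u) + pi :> R by rewrite -natr1; ring.
  by rewrite cosDpi IH /= signrN mulNr.
case: i => n; first exact: nat_case.
rewrite NegzE -cosN abszN /=.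
have -> : - (pi * (- n.+1%:Z)%:~R + t) = pi * n.+1%:R + (- t).
  by rewrite intrN -pmulrn; ring.
by rewrite nat_case cosN.
Qed.

Lemma seq_pos_lb (l : seq R) : (forall z, z \in l -> 0 < z) ->
  exists2 e, 0 < e & forall z, z \in l -> e <= z.
Proof.
elim: l => [|z l IH] l0; first by exists 1.
have [t tl|e e0 he] := IH; first by apply: l0; rewrite inE tl orbT.
have z0 : 0 < z by apply: l0; rewrite mem_head.
exists (Num.min z e); first by rewrite lt_min z0.
move=> t; rewrite inE => /orP[/eqP ->|tl]; first by rewrite ge_min lexx.
by rewrite ge_min he ?orbT.
Qed.

Lemma invN_cvg0 : (N%:R : R)^-1 @[N --> \oo] --> (0 : R).
Proof.
apply/cvgr0Pnorm_le => e e0; near=> N.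
have eN : e^-1 <= N%:R by near: N; exact: nbhs_infty_ger.
have N0 : 0 < N%:R :> R by rewrite (lt_le_trans _ eN) // invr_gt0.
by rewrite ger0_norm ?invr_ge0 // -[e]invrK lef_pV2 ?posrE ?invr_gt0.
Unshelve. all: by end_near. Qed.

Lemma K0_gt0 : 0 < K0 R.
Proof. by rewrite /K0 divr_gt0 // sqrtr_gt0. Qed.

Lemma norm_cos_le1 (t : R) : `|cos t| <= 1.
Proof. by rewrite ler_norml cos_geN1 cos_le1. Qed.

Lemma norm_sin_le1 (t : R) : `|sin t| <= 1.
Proof. by rewrite ler_norml sin_geN1 sin_le1. Qed.

Section EigenAsymptotics.
Variables (alpha beta : R) (p r : R -> R) (lam : int -> R).
Variables (v : int -> R -> 'cV[R]_2) (kp km : int -> R) (m : nat -> int).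
Hypothesis hlam_asym : bigO_inv (fun i : int =>
      lam i - (pi * i%:~R / 2 - theta_t alpha beta p r / 2)).
Hypothesis hv1 : unif_bigO_inv (fun (i : int) (x : R) =>
      v i x 0 0 - K0 R * cos (xi p r lam i x - alpha)).
Hypothesis hv2 : unif_bigO_inv (fun (i : int) (x : R) =>
      v i x 1 0 - K0 R * sin (xi p r lam i x - alpha)).
Hypothesis hkp : forall i : int, v i 1 = kp i *: col2 (cos beta) (- sin beta).
Hypothesis hkm : forall i : int, v i (-1) = km i *: col2 (cos alpha) (- sin alpha).
Hypothesis hm : forall n0 : nat, \forall N \near \oo, (n0 <= `|m N|)%N.

Lemma eigen_bounded1 : \forall N \near \oo, forall x, I11 x -> `|v (m N) x 0 0| <= K0 R + 1.
Proof.
have := unif_bigO_small hv1 hm ltr01; apply: filterS => N H x /H {}H.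
rewrite -[v _ _ _ _](subrK (K0 R * cos (xi p r lam (m N) x - alpha))) addrC.
rewrite (le_trans (ler_normD _ _)) // lerD // normrM (gtr0_norm K0_gt0).
by rewrite ler_piMr ?norm_cos_le1 // ltW // K0_gt0.
Qed.

Lemma eigen_bounded2 : \forall N \near \oo, forall x, I11 x -> `|v (m N) x 1 0| <= K0 R + 1.
Proof.
have := unif_bigO_small hv2 hm ltr01; apply: filterS => N H x /H {}H.
rewrite -[v _ _ _ _](subrK (K0 R * sin (xi p r lam (m N) x - alpha))) addrC.
rewrite (le_trans (ler_normD _ _)) // lerD // normrM (gtr0_norm K0_gt0).
by rewrite ler_piMr ?norm_sin_le1 // ltW // K0_gt0.
Qed.

Lemma boundary_coef (k gam : R) (w : 'cV[R]_2) : w = k *: col2 (cos gam) (- sin gam) ->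
  k = w 0 0 * cos gam - w 1 0 * sin gam.
Proof.
move=> ->; rewrite !mxE /= -[LHS]mulr1 -(cos2Dsin2 gam); ring.
Qed.

Lemma boundary_coef_error (e1 e2 a b eps : R) : `|e1| <= eps -> `|e2| <= eps ->
  `|e1 * cos a - e2 * sin b| <= eps + eps.
Proof.
move=> h1 h2; rewrite (le_trans (ler_normB _ _)) // !normrM lerD //.
  by rewrite -[leRHS]mulr1 ler_pM // norm_cos_le1.
by rewrite -[leRHS]mulr1 ler_pM // norm_sin_le1.
Qed.

Lemma km_near (eps : R) : 0 < eps -> \forall N \near \oo, `|km (m N) - K0 R| <= eps.
Proof.
move=> eps0; have e2 : 0 < eps / 2 by rewrite divr_gt0.
have := unif_bigO_small hv1 hm e2; have := unif_bigO_small hv2 hm e2.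
apply: filterS2 => N /(_ _ (@I11_N1 R)) E2 /(_ _ (@I11_N1 R)) E1.
have xi0 : xi p r lam (m N) (-1) = 0.
  by rewrite /xi addNr mulr0 add0r set_itv1 Rintegral_set1 mulr0.
rewrite xi0 sub0r cosN sinN in E1 E2.
have := boundary_coef_error alpha alpha E1 E2.
rewrite (boundary_coef (hkm (m N))) -[X in _ <= X -> _]splitr.
congr (`| _ | <= _).
rewrite -[in RHS](mulr1 (K0 R)) -(cos2Dsin2 alpha); ring.
Qed.

(** Since [2 lam = pi n - theta_t + o(1)], the phase [xi - alpha] at 1 is [pi n
    - beta + o(1)]. *)
Lemma kp_near (eps : R) : 0 < eps ->
  \forall N \near \oo, `|kp (m N) - (-1) ^+ odd `|m N| * K0 R| <= eps.
Proof.
move=> eps0; have e2 : 0 < eps / 4 by rewrite divr_gt0.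
have e3 : 0 < eps / (2 * K0 R) by rewrite divr_gt0 // mulr_gt0 ?K0_gt0.
have cos1 : cos (2 * (lam (m N) - (pi * (m N)%:~R / 2 - theta_t alpha beta p r / 2)))
    @[N --> \oo] --> cos (0 : R).
  pose t N := 2 * (lam (m N) - (pi * (m N)%:~R / 2 - theta_t alpha beta p r / 2)).
  have t0 : t N @[N --> \oo] --> (0 : R).
    rewrite -[X in _ --> X](mulr0 2); apply: cvgM; first exact: cvg_cst.
    exact: (bigO_cvg0 hlam_asym hm).
  have cc : cos u @[u --> (0 : R)] --> cos (0 : R) by exact: continuous_cos.
  have H := @cvg_comp nat R R t cos \oo (nbhs (0 : R)) (nbhs (cos (0 : R))) t0 cc.
  exact: H.
rewrite cos0 in cos1.
move/cvgrPdist_le : cos1 => /(_ _ e3).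
have := unif_bigO_small hv1 hm e2; have := unif_bigO_small hv2 hm e2.
apply: filterS3 => N /(_ _ (@I11_1 R)) E2 /(_ _ (@I11_1 R)) E1.
set t := 2 * _ => Et.
have B := boundary_coef_error beta beta E1 E2.
have xiE : xi p r lam (m N) 1 - alpha + beta = pi * (m N)%:~R + t.
  by rewrite /xi /t /theta_t; field.
have sg1 : `|(-1) ^+ odd `|m N| : R| = 1 by rewrite normrX normrN1 expr1n.
have C : `|K0 R * ((-1) ^+ odd `|m N| * (cos t - 1))| <= eps / 2.
  rewrite normrM (gtr0_norm K0_gt0) normrM sg1 mul1r distrC.
  rewrite [leLHS]mulrC -ler_pdivlMr ?K0_gt0 //.
  by rewrite -mulrA -invfM.
rewrite (boundary_coef (hkp (m N))).
rewrite (_ : _ - _ = ((v (m N) 1 0 0 - K0 R * cos (xi p r lam (m N) 1 - alpha)) * cos beta -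
   (v (m N) 1 1 0 - K0 R * sin (xi p r lam (m N) 1 - alpha)) * sin beta) +
   K0 R * ((-1) ^+ odd `|m N| * (cos t - 1))); last first.
  have := cos_int_pi (m N) t; rewrite -xiE cosD.
  set sg : R := _ ^+ odd _; set k : R := K0 R; set c : R := cos (_ - _).
  set s : R := sin (_ - _) => cosE.
  by rewrite (mulrBr sg) -cosE; ring.
by rewrite (le_trans (ler_normD _ _)) //; move: B C; lra.
Qed.

Lemma lam_ratio (c : R) : (m N)%:~R / N%:R @[N --> \oo] --> c ->
  lam (m N) / N%:R @[N --> \oo] --> pi * c / 2.
Proof.
move=> mc; set th := theta_t alpha beta p r.
have iN := invN_cvg0.
rewrite [X in X @ _](_ : _ = fun N => pi * ((m N)%:~R / N%:R) / 2 - (th / 2) * N%:R^-1 +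
   (lam (m N) - (pi * (m N)%:~R / 2 - th / 2)) * N%:R^-1); last first.
  by apply/funext => N; ring.
rewrite -[X in _ --> X]addr0; apply: cvgD.
  rewrite -[X in _ --> X]subr0; apply: cvgB.
    by apply: cvgM; [apply: cvgM => //; exact: cvg_cst|exact: cvg_cst].
  rewrite -(mulr0 (th / 2)); apply: cvgM => //; exact: cvg_cst.
rewrite -(mulr0 (0 : R)); apply: cvgM; last exact: iN.
exact: (bigO_cvg0 hlam_asym hm).
Qed.

End EigenAsymptotics.
End Limits.

(** * Regular index sets and the KEG system *)

Section RegularIndices.
Variables (R : realType) (m q : nat).
Implicit Types (x kp km t : int -> R) (ns : 'I_m -> int) (M eta K C d del w : R).

(** What is needed of the indices and of the eigendata at one value of [w = N]:
    the rescaled nodes [w * x (ns s)] are bounded by [M] and, within each parity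
    class, [eta]-separated; the boundary scalars are within [del] of their limits
    [(-1)^n K] and [K], and the remainder [t] of the expansion is at most [del]. *)
Definition regular_indices w M eta K del x kp km t ns : Prop :=
  let sep (A : {set 'I_m}) := {in A &, forall s u, s != u ->
    eta <= `|w * x (ns s) - w * x (ns u)|} in
  [/\ #|Eset ns| = q /\ #|Oset ns| = q,
      sep (Eset ns) /\ sep (Oset ns),
      forall s, `|w * x (ns s)| <= M
    & forall s, [/\ `|kp (ns s) - (-1) ^+ odd `|ns s| * K| <= del,
                    `|km (ns s) - K| <= del & `|t (ns s)| <= del]].

Lemma regular_stability M eta K : 0 <= M -> 0 < eta -> 0 < K ->
  exists C d, [/\ 0 <= C, 0 < d & forall w del x kp km t ns (a b : 'rV[R]_q) e,
    regular_indices w M eta K del x kp km t ns -> del <= d ->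
    (forall s, `|\sum_(k < q) (w * x (ns s)) ^+ k *
                  (kp (ns s) * a 0 k - km (ns s) * b 0 k)| <= e) ->
    forall k, `|a 0 k| <= C * e /\ `|b 0 k| <= C * e].
Proof.
move=> M0 eta0 K0; have [C [d [C0 d0 stab]]] := @parity_stability R m q M eta K M0 eta0 K0.
exists C, d; split=> // w del x kp km t ns a b e [[cE cO] [sepE sepO] xM near] deld H.
apply: (stab (fun s => w * x (ns s)) (fun s => kp (ns s)) (fun s => km (ns s))
  _ _ a b e cE cO xM sepE sepO) => // s.
- rewrite inE => /negbTE od; have [] := near s; rewrite od expr0 mul1r.
  by move=> /le_trans/(_ deld).
- rewrite inE => od; have [] := near s; rewrite od expr1 mulN1r opprK.
  by move=> /le_trans/(_ deld).
- by have [_ /le_trans/(_ deld)] := near s.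
Qed.

Lemma regular_keg_error M eta K : 0 <= M -> 0 < eta -> 0 < K ->
  exists C d, [/\ 0 <= C, 0 < d &
    forall w del x kp km t ns (c : int -> R) (gp gm : 'rV[R]_q) (Gp Gm : nat -> R),
    regular_indices w M eta K del x kp km t ns -> del <= d -> 0 < w ->
    (forall i, x i != 0) ->
    (forall i, c i = x i * \sum_(k < q) x i ^+ k * (kp i * Gp k - km i * Gm k) +
       x i ^+ q.+1 * (kp i * Gp q - km i * Gm q + t i)) ->
    keg_system x c kp km ns gp gm -> forall k,
    `|scaled_error w gp Gp (Gp q) (Gm q) (Uplus x ns) (Vplus x ns) 0 k| <= C * del *
        (M ^+ q + (`|Gp q| + `|Gm q|) * (M + M) ^+ q) /\
    `|scaled_error w gm Gm (Gp q) (Gm q) (Uminus x ns) (Vminus x ns) 0 k| <= C * del *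
        (M ^+ q + (`|Gp q| + `|Gm q|) * (M + M) ^+ q)].
Proof.
move=> M0 eta0 K0; have [C [d [C0 d0 stab]]] := regular_stability M0 eta0 K0.
exists C, d; split=> // w del x kp km t ns c gp gm Gp Gm reg deld w0 x0 cE sys k.
rewrite -(mulrA C); apply: (stab _ _ _ _ _ _ _ _ _ _ reg deld) => s.
have [[cardE cardO] _ xM near] := reg; have [k1 k2 tdel] := near s.
apply: (@keg_residual R q m x ns cardE cardO _ _ _ _ _ _ (t (ns s)) _ _ _ _ s) => //.
- have := sys s; rewrite cE exprS -mulrA -mulrDr => /(mulfI (x0 _)) <-.
  by [].
- rewrite inE => /negbTE od; move: k1; rewrite od expr0 mul1r => k1.
  rewrite (_ : _ - _ = (kp (ns s) - K) - (km (ns s) - K)); last by ring.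
  by rewrite (le_trans (ler_normB _ _)) // mulrDl mul1r lerD.
- rewrite inE => od; move: k1; rewrite od expr1 mulN1r opprK => k1.
  rewrite (_ : _ + _ = (kp (ns s) + K) + (km (ns s) - K)); last by ring.
  by rewrite (le_trans (ler_normD _ _)) // mulrDl mul1r lerD.
Qed.

(** From [z s != z u] to a uniform gap, as there are finitely many indices. *)
Lemma separation_constant (z : 'I_m -> R) :
  exists2 eta, 0 < eta & forall s u, z s != z u -> 2 * eta <= `|z s - z u|.
Proof.
have [_ /mapP[[s u] + ->]|eta eta0 h] := @seq_pos_lb R [seq `|z p.1 - z p.2| / 2 |
    p <- enum [pred p : 'I_m * 'I_m | z p.1 != z p.2]].
  by rewrite mem_enum inE /= => zsu; rewrite divr_gt0 // normr_gt0 subr_eq0.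
exists eta => // s u zsu; rewrite mulrC -ler_pdivlMr //; apply: h.
by apply/mapP; exists (s, u) => //; rewrite mem_enum inE.
Qed.

Lemma eventually_regular K x kp km t (z : 'I_m -> R) (ns : nat -> 'I_m -> int) :
  (forall s, N%:R * x (ns N s) @[N --> \oo] --> z s) ->
  (\forall N \near \oo, #|Eset (ns N)| = q /\ #|Oset (ns N)| = q) ->
  (\forall N \near \oo, {in Eset (ns N) &, injective z} /\
                        {in Oset (ns N) &, injective z}) ->
  (forall s del, 0 < del ->
    [/\ \forall N \near \oo, `|kp (ns N s) - (-1) ^+ odd `|ns N s| * K| <= del,
        \forall N \near \oo, `|km (ns N s) - K| <= del
      & \forall N \near \oo, `|t (ns N s)| <= del]) ->
  exists M eta, [/\ 0 <= M, 0 < eta & forall del, 0 < del -> \forall N \near \oo,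
    (0 < N)%N /\ regular_indices N%:R M eta K del x kp km t (ns N)].
Proof.
move=> xz card inj lims; have [eta eta0 heta] := separation_constant z.
pose M := 1 + \sum_s `|z s|.
have M0 : 0 <= M by rewrite addr_ge0 // sumr_ge0.
exists M, eta; split=> // del del0.
have near1 : \forall N \near \oo, forall s,
    `|z s - N%:R * x (ns N s)| <= Num.min 1 (eta / 2).
  apply: filter_forall => s; move/cvgrPdist_le : (xz s); apply.
  by rewrite lt_min ltr01 divr_gt0.
have near2 : \forall N \near \oo, forall s,
    [/\ `|kp (ns N s) - (-1) ^+ odd `|ns N s| * K| <= del,
        `|km (ns N s) - K| <= del & `|t (ns N s)| <= del].
  by apply: filter_forall => s; have [] := lims s del del0; exact: filterS3.
near=> N.
have Y : forall s, `|z s - N%:R * x (ns N s)| <= Num.min 1 (eta / 2) by near: N.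
have Y1 s : `|z s - N%:R * x (ns N s)| <= 1.
  by apply: le_trans (Y s) _; rewrite ge_min lexx.
have Y2 s : `|z s - N%:R * x (ns N s)| <= eta / 2.
  by apply: le_trans (Y s) _; rewrite ge_min lexx orbT.
have sep s u : z s != z u -> eta <= `|N%:R * x (ns N s) - N%:R * x (ns N u)|.
  move=> zsu; have := heta _ _ zsu; have := Y2 s; have := Y2 u.
  move: (N%:R * x (ns N s)) (N%:R * x (ns N u)) => ys yu.
  rewrite (_ : z s - z u = (z s - ys) + (ys - yu) - (z u - yu)); last by ring.
  have := ler_normB (z s - ys + (ys - yu)) (z u - yu).
  have := ler_normD (z s - ys) (ys - yu).
  move: `|_ - (z u - yu)| `|z s - ys + (ys - yu)| `|z s - ys| `|ys - yu| `|z u - yu|.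
  by clear; move=> *; lra.
have [injE injO] : {in Eset (ns N) &, injective z} /\ {in Oset (ns N) &, injective z}.
  by near: N.
split; first by near: N; exact: nbhs_infty_gt.
split.
- by near: N.
- split=> s u sA uA su; apply: sep; apply: contra_neq su.
    exact: injE.
  exact: injO.
- move=> s; rewrite -[N%:R * _](subKr (z s)) (le_trans (ler_normB _ _)) // addrC /M.
  by rewrite lerD // (bigD1 s) //= lerDl sumr_ge0.
- by near: N.
Unshelve. all: by end_near. Qed.

(** The roots of [PiE] and [PiO] are at most [M / w] in modulus. *)
Lemma regular_coef_bound w M eta K del x kp km t ns k : 0 <= M -> 0 < w -> (k <= q)%N ->
  regular_indices w M eta K del x kp km t ns ->
  `|w ^+ (q - k) * (Uplus x ns)`_k| <= 2 ^+ q * M ^+ (q - k) /\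
  `|w ^+ (q - k) * (Uminus x ns)`_k| <= 2 ^+ q * M ^+ (q - k).
Proof.
move=> M0 w0 kq [[cE cO] _ xM _].
have xMw s : `|x (ns s)| <= M / w.
  by rewrite ler_pdivlMr // mulrC -{1}(gtr0_norm w0) -normrM xM.
have wq0 : 0 < w ^+ (q - k) by rewrite exprn_gt0.
have coef (A : {set 'I_m}) : #|A| = q ->
    `|w ^+ (q - k) * (\prod_(s in A) ('X - (x (ns s))%:P))`_k| <= 2 ^+ q * M ^+ (q - k).
  move=> cA; rewrite normrM (gtr0_norm wq0) mulrC -ler_pdivlMr // -mulrA -expr_div_n.
  by apply: prod_set_coef_bound => //; rewrite divr_ge0 // ltW.
have := coef _ cE; have := coef _ cO; rewrite -/(PiE x ns) -/(PiO x ns).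
rewrite /Uplus /Uminus coefN !coefZ coefB coefD.
move: (PiE x ns)`_k (PiO x ns)`_k => e o ho he.
have dbl (B : R) : 2 * B = B + B by ring.
have half1 : `|w ^+ (q - k) * (2^-1 * (e + o))| <= 2 ^+ q * M ^+ (q - k).
  rewrite [X in `|X|](_ : _ = 2^-1 * (w ^+ (q - k) * e + w ^+ (q - k) * o)); last by ring.
  rewrite normrM (ger0_norm (_ : 0 <= 2^-1)) // ler_pdivrMl //.
  by rewrite (le_trans (ler_normD _ _)) // mulr2n mulrDl mul1r lerD.
have half2 : `|w ^+ (q - k) * - (2^-1 * (e - o))| <= 2 ^+ q * M ^+ (q - k).
  rewrite [X in `|X|](_ : _ = - (2^-1 * (w ^+ (q - k) * e - w ^+ (q - k) * o))); last by ring.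
  rewrite normrN normrM (ger0_norm (_ : 0 <= 2^-1)) // ler_pdivrMl //.
  by rewrite (le_trans (ler_normB _ _)) // mulr2n mulrDl mul1r lerD.
by split.
Qed.

Lemma scaled_difference w (g : 'rV[R]_q) (G : nat -> R) a b (P Q : {poly R}) (k : 'I_q) e B :
  `|scaled_error w g G a b P Q 0 k| <= e ->
  `|w ^+ (q - k) * P`_k| <= B -> `|w ^+ (q - k) * Q`_k| <= B ->
  `|w ^+ (q - k) * (g 0 k - G k)| <= e + (`|a| + `|b|) * B.
Proof.
rewrite mxE => he hP hQ.
rewrite (_ : _ * _ = w ^+ (q - k) * (g 0 k - (G k - a * P`_k - b * Q`_k)) -
  (a * (w ^+ (q - k) * P`_k) + b * (w ^+ (q - k) * Q`_k))); last by ring.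
rewrite (le_trans (ler_normB _ _)) // lerD // (le_trans (ler_normD _ _)) //.
by rewrite !(normrM a, normrM b) mulrDl lerD // ler_wpM2l.
Qed.

End RegularIndices.

(** A solution of the homogeneous system has scaled coefficients bounded by [C
    * 0]. *)
Lemma regular_keg_unique (R : realType) (q : nat) (M eta K : R) :
  0 <= M -> 0 < eta -> 0 < K ->
  exists2 d : R, 0 < d & forall (w del : R) (x kp km t c : int -> R)
    (ns : 'I_(2 * q) -> int),
    regular_indices q w M eta K del x kp km t ns -> del <= d -> 0 < w ->
    (forall i, x i != 0) ->
    exists! g : 'rV[R]_q * 'rV[R]_q, keg_system x c kp km ns g.1 g.2.
Proof.
move=> M0 eta0 K0.
have [C [d [C0 d0 stab]]] := @regular_stability R (2 * q) q M eta K M0 eta0 K0.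
exists d => // w del x kp km t c ns reg deld w0 x0.
apply: keg_unique_solution => a b hab.
pose sc (u : 'rV[R]_q) : 'rV[R]_q := \row_(k < q) (w ^+ (q - k) * u 0 k).
have sc0 (u : 'rV[R]_q) : (forall k, `|sc u 0 k| <= 0) -> u = 0.
  move=> hu; apply/rowP => k; have := hu k; rewrite !mxE normr_le0 mulf_eq0.
  by rewrite expf_eq0 (gt_eqF w0) andbF /= => /eqP.
have H : forall k, `|sc a 0 k| <= C * 0 /\ `|sc b 0 k| <= C * 0.
  apply: (stab _ _ _ _ _ _ _ _ _ _ reg deld) => s.
  rewrite (_ : \sum_(k < q) _ = 0) ?normr0 //.
  transitivity (w ^+ q * \sum_(k < q) x (ns s) ^+ k *
      (kp (ns s) * a 0 k - km (ns s) * b 0 k)); last first.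
    have /esym/eqP := hab s.
    by rewrite mulf_eq0 (negbTE (x0 _)) /= => /eqP ->; rewrite mulr0.
  rewrite mulr_sumr; apply: eq_bigr => k _; rewrite !mxE exprMn.
  have -> : w ^+ q = w ^+ (q - k) * w ^+ k by rewrite -exprD subnK // ltnW.
  by ring.
by rewrite mulr0 in H; split; apply: sc0 => k; have [] := H k.
Qed.

(** * From scaled bounds to the Landau notation *)

Section ScaledLandau.
Variables (R : realType) (k q : nat) (u : nat -> R).
Hypothesis kq : (k <= q)%N.

Lemma scaled_small (N : nat) (z eps : R) : (0 < N)%N ->
  `|N%:R ^+ (q - k) * z| <= eps -> `|z| <= eps * `|N%:R ^ (k%:Z - q%:Z) : R|.
Proof.
move=> N0; have NR : 0 < N%:R :> R by rewrite ltr0n.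
have -> : k%:Z - q%:Z = - (q - k)%N%:Z by lia.
rewrite -exprnN normrM (ger0_norm (exprn_ge0 _ (ltW NR))).
rewrite [`|_ ^- _|]ger0_norm ?invr_ge0 ?exprn_ge0 ?(ltW NR) //.
by rewrite ler_pdivlMr ?exprn_gt0 // mulrC.
Qed.

Lemma littleo_scaled :
  (forall eps : R, 0 < eps -> \forall N \near \oo, `|N%:R ^+ (q - k) * u N| <= eps) ->
  u =o_\oo (fun N : nat => N%:R ^ (k%:Z - q%:Z) : R).
Proof.
move=> hu; apply/eqoP => eps eps0; near=> N; apply: scaled_small.
  by near: N; exact: nbhs_infty_gt.
by near: N; exact: hu.
Unshelve. all: by end_near. Qed.

Lemma bigO_scaled (B : R) :
  (\forall N \near \oo, `|N%:R ^+ (q - k) * u N| <= B) ->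
  u =O_\oo (fun N : nat => N%:R ^ (k%:Z - q%:Z) : R).
Proof.
move=> hu; apply/eqOP; near=> K; near=> N; apply: scaled_small.
  by near: N; exact: nbhs_infty_gt.
apply: (@le_trans _ _ B); first by near: N.
by near: K; apply: nbhs_pinfty_ge; rewrite num_real.
Unshelve. all: by end_near. Qed.

End ScaledLandau.

Theorem theorem3p4 (R : realType) (q : nat) (alpha beta : R) (p r : R -> R)
    (f : R -> 'cV[R]_2) (lam : int -> R) (v : int -> R -> 'cV[R]_2)
    (kp km : int -> R) (alpha0 : R)
    (n : nat -> 'I_(2 * q) -> int) (c : 'I_(2 * q) -> R)
  (hq : (1 <= q)%N)
  (halpha : 0 <= alpha <= pi) (hbeta : 0 <= beta <= pi)
  (hp : classC q p) (hr : classC q r)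
  (hf : classC q (comp1 f) /\ classC q (comp2 f))
  (hfac : abs_continuousI (derivnI q (comp1 f)) /\
          abs_continuousI (derivnI q (comp2 f)))
  (h0 : ~ is_eigenvalue alpha beta p r 0)
  (* the eigenvalues and their indexing *)
  (hlam_mono : forall i j : int, i < j -> lam i < lam j)
  (hlam_spec : forall mu : R,
      is_eigenvalue alpha beta p r mu <-> exists i : int, mu = lam i)
  (hlam_asym : bigO_inv (fun i : int =>
      lam i - (pi * i%:~R / 2 - theta_t alpha beta p r / 2)))
  (* the orthonormal eigenfunctions and their signs *)
  (hv_eig : forall i : int, is_eigenfunction alpha beta p r (lam i) (v i))
  (hv_orth : forall i j : int, inner2 (v i) (v j) = (i == j)%:R)
  (hv1 : unif_bigO_inv (fun (i : int) (x : R) =>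
      v i x 0 0 - K0 R * cos (xi p r lam i x - alpha)))
  (hv2 : unif_bigO_inv (fun (i : int) (x : R) =>
      v i x 1 0 - K0 R * sin (xi p r lam i x - alpha)))
  (hkp : forall i : int, v i 1 = kp i *: col2 (cos beta) (- sin beta))
  (hkm : forall i : int, v i (-1) = km i *: col2 (cos alpha) (- sin alpha))
  (* the indices n_s(N) *)
  (halpha0 : 0 < alpha0 < 1)
  (hn_inj : \forall N \near \oo, injective (n N))
  (hn_neq0 : \forall N \near \oo, forall s, n N s != 0)
  (hn_bnd : \forall N \near \oo, forall s,
      alpha0 * N%:R <= `|n N s|%:~R /\ `|n N s| <= N%:Z)
  (hc : forall s, (n N s)%:~R / N%:R @[N --> \oo] --> c s)
  (hc_neq0 : forall s, c s != 0)
  (hcard : \forall N \near \oo,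
      #|Eset (n N)| = q /\ #|Oset (n N)| = q)
  (hc_dist : \forall N \near \oo,
      {in Eset (n N) &, injective c} /\ {in Oset (n N) &, injective c}) :
  let x (i : int) : R := (lam i)^-1 in
  let fc (i : int) : R := inner2 (v i) f in
  let gplus (k : nat) : R := gred p r f beta 1 k in
  let gminus (k : nat) : R := gred p r f alpha (-1) k in
  (\forall N \near \oo, exists! g : 'rV[R]_q * 'rV[R]_q,
      keg_system x fc kp km (n N) g.1 g.2) /\
  forall gp gm : nat -> 'rV[R]_q,
    (\forall N \near \oo, keg_system x fc kp km (n N) (gp N) (gm N)) ->
    forall k : 'I_q,
      [/\ (fun N : nat => gp N 0 k - (gplus k - gplus q * (Uplus x (n N))`_k
                                       - gminus q * (Vplus x (n N))`_k) : R)
            =o_\oo (fun N : nat => N%:R ^ (k%:Z - q%:Z) : R),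
          (fun N : nat => gm N 0 k - (gminus k - gplus q * (Uminus x (n N))`_k
                                       - gminus q * (Vminus x (n N))`_k) : R)
            =o_\oo (fun N : nat => N%:R ^ (k%:Z - q%:Z) : R),
          (fun N : nat => gp N 0 k - gplus k : R)
            =O_\oo (fun N : nat => N%:R ^ (k%:Z - q%:Z) : R)
        & (fun N : nat => gm N 0 k - gminus k : R)
            =O_\oo (fun N : nat => N%:R ^ (k%:Z - q%:Z) : R)].
Proof.
move=> x fc gplus gminus.
have lamN0 i : lam i != 0.
  by apply/eqP => li; apply: h0; apply/hlam_spec; exists i.
have x0 i : x i != 0 by rewrite invr_eq0.
have ACp : ACn q.-1 p by apply: classC_ACn; rewrite prednK.
have ACr : ACn q.-1 r by apply: classC_ACn; rewrite prednK.
have ACf : ACv q f.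
  by split; apply: classC_AC_ACn; [exact: hf.1|exact: hfac.1|exact: hf.2|exact: hfac.2].
have n_large s (n0 : nat) : \forall N \near \oo, (n0 <= `|n N s|)%N.
  near=> N.
  have [b1 _] : alpha0 * N%:R <= `|n N s|%:~R /\ `|n N s| <= N%:Z.
    by move: s; near: N; exact: hn_bnd.
  have a0 : 0 < alpha0 by case/andP: halpha0.
  have N1 : n0%:R / alpha0 <= N%:R by near: N; exact: nbhs_infty_ger.
  rewrite -(ler_nat R); apply: le_trans (_ : alpha0 * N%:R <= _).
    by rewrite mulrC -ler_pdivrMr.
  by rewrite (le_trans b1) // -abszE pmulrn.
(* the limits of the rescaled nodes, as lam i is close to pi i / 2 *)
pose z s : R := (pi * c s / 2)^-1.
have nodes s : N%:R * x (n N s) @[N --> \oo] --> z s.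
  rewrite [X in X @ _](_ : _ = fun N : nat => (lam (n N s) / N%:R)^-1); last first.
    by apply/funext => N; rewrite invf_div.
  apply: cvgV; last exact: (lam_ratio hlam_asym (n_large s) (hc s)).
  by rewrite !mulf_neq0 ?invr_eq0 ?hc_neq0 // gt_eqF ?pi_gt0.
have x_cvg0 s : x (n N s) @[N --> \oo] --> (0 : R).
  rewrite -(mulr0 (z s)); apply: cvg_trans (cvgM (nodes s) (@invN_cvg0 R)).
  apply: near_eq_cvg; near=> N; rewrite /= mulrAC divff ?mul1r //.
  by rewrite pnatr_eq0 -lt0n; near: N; exact: nbhs_infty_gt.
have z_inj : injective (fun a : R => (pi * a / 2)^-1).
  have p0 : pi != 0 :> R by rewrite gt_eqF ?pi_gt0.
  have t0 : 2^-1 != 0 :> R by rewrite invr_eq0 pnatr_eq0.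
  by move=> a b /invr_inj/(mulIf t0)/(mulfI p0).
pose tl := expansion_tail q alpha beta p r f lam v kp km.
have limits s (del : R) : 0 < del ->
    [/\ \forall N \near \oo, `|kp (n N s) - (-1) ^+ odd `|n N s| * K0 R| <= del,
        \forall N \near \oo, `|km (n N s) - K0 R| <= del
      & \forall N \near \oo, `|tl (n N s)| <= del].
  move=> del0; split.
  - exact: (kp_near hlam_asym hv1 hv2 hkp (n_large s) del0).
  - exact: (km_near hv1 hv2 hkm (n_large s) del0).
  - (* K0 + 1 bounds the components of the eigenfunctions *)
    have tl0 : tl (n N s) @[N --> \oo] --> (0 : R).
      apply: (@expansion_tail_cvg0 R q alpha beta p r f lam v kp km ACp ACr ACf
        hv_eig hkp hkm (fun N => n N s) (K0 R + 1)).
      + exact: x_cvg0.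
      + by near=> N.
      + exact: eigen_bounded1 hv1 (n_large s).
      + exact: eigen_bounded2 hv2 (n_large s).
    by move/cvgr0Pnorm_le : tl0 => /(_ _ del0).
have z_dist : \forall N \near \oo, {in Eset (n N) &, injective z} /\
                                   {in Oset (n N) &, injective z}.
  apply: filterS hc_dist => N [injE injO].
  by split=> s u sA uA /z_inj; [exact: injE|exact: injO].
have [M [eta [M0 eta0 regular]]] := eventually_regular nodes hcard z_dist limits.
have [d1 d10 unique] := @regular_keg_unique R q M eta (K0 R) M0 eta0 (K0_gt0 R).
have [C [d [C0 d0 error]]] :=
  @regular_keg_error R (2 * q) q M eta (K0 R) M0 eta0 (K0_gt0 R).
split.
  apply: filterS (regular _ d10) => N [N0 reg].
  by apply: (unique _ _ _ _ _ _ _ _ reg) => //; rewrite ltr0n.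
move=> gp gm hsys.
have expansion i : fc i =
    x i * \sum_(k < q) x i ^+ k * (kp i * gplus k - km i * gminus k) +
    x i ^+ q.+1 * (kp i * gplus q - km i * gminus q + tl i).
  exact: (coef_expansion ACp ACr ACf hv_eig hkp hkm (lamN0 i)).
pose W := M ^+ q + (`|gplus q| + `|gminus q|) * (M + M) ^+ q.
have W0 : 0 <= W.
  by rewrite addr_ge0 ?exprn_ge0 // mulr_ge0 ?addr_ge0 // exprn_ge0 // addr_ge0.
have small (eps : R) : 0 < eps -> \forall N \near \oo, forall k : 'I_q,
    `|scaled_error N%:R (gp N) gplus (gplus q) (gminus q)
        (Uplus x (n N)) (Vplus x (n N)) 0 k| <= eps /\
    `|scaled_error N%:R (gm N) gminus (gplus q) (gminus q)
        (Uminus x (n N)) (Vminus x (n N)) 0 k| <= eps.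
  move=> eps0; have CW : 0 < C * W + 1 by rewrite ltr_wpDl // mulr_ge0.
  pose del := Num.min d (eps / (C * W + 1)).
  have del0 : 0 < del by rewrite lt_min d0 divr_gt0.
  have delW : C * del * W <= eps.
    rewrite mulrAC (@le_trans _ _ ((C * W + 1) * del)) //.
      by rewrite ler_wpM2r ?(ltW del0) // lerDl.
    by rewrite mulrC -ler_pdivlMr // ge_min lexx orbT.
  near=> N => k.
  have sysN : keg_system x fc kp km (n N) (gp N) (gm N) by near: N.
  have [N0 reg] : (0 < N)%N /\
      regular_indices q N%:R M eta (K0 R) del x kp km tl (n N).
    by near: N; exact: regular.
  have [||Ep Em] := error _ _ _ _ _ _ _ _ _ _ _ _ reg _ _ x0 expansion sysN k.
  - by rewrite ge_min lexx.
  - by rewrite ltr0n.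
  by split; [exact: le_trans Ep delW|exact: le_trans Em delW].
have bounded : \forall N \near \oo, forall k : 'I_q,
    `|N%:R ^+ (q - k) * (gp N 0 k - gplus k)| <=
       1 + (`|gplus q| + `|gminus q|) * (2 ^+ q * M ^+ (q - k)) /\
    `|N%:R ^+ (q - k) * (gm N 0 k - gminus k)| <=
       1 + (`|gplus q| + `|gminus q|) * (2 ^+ q * M ^+ (q - k)).
  near=> N => k.
  have [N0 reg] : (0 < N)%N /\
      regular_indices q N%:R M eta (K0 R) 1 x kp km tl (n N).
    by near: N; exact: regular.
  have S : forall k : 'I_q,
      `|scaled_error N%:R (gp N) gplus (gplus q) (gminus q)
          (Uplus x (n N)) (Vplus x (n N)) 0 k| <= 1 /\
      `|scaled_error N%:R (gm N) gminus (gplus q) (gminus q)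
          (Uminus x (n N)) (Vminus x (n N)) 0 k| <= 1.
    by near: N; exact: small.
  have NR : 0 < N%:R :> R by rewrite ltr0n.
  have [Ep Em] := S k.
  have [Bp Bm] := regular_coef_bound M0 NR (ltnW (ltn_ord k)) reg.
  by split; [exact: scaled_difference Ep Bp Bm|exact: scaled_difference Em Bm Bp].
move=> k; have kq : (k <= q)%N by exact: ltnW.
split.
- apply: littleo_scaled => // eps /small.
  by apply: filterS => N /(_ k)[]; rewrite !mxE.
- apply: littleo_scaled => // eps /small.
  by apply: filterS => N /(_ k)[]; rewrite !mxE.
- by apply: (bigO_scaled kq); apply: filterS bounded => N /(_ k)[h _]; exact: h.
- by apply: (bigO_scaled kq); apply: filterS bounded => N /(_ k)[_ h]; exact: h.
Unshelve. all: by end_near. Qed.
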